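(* Fix $r\in\mathbb{N}$, $\beta\in(0,1/\lambda_1)$, $\epsilon>0$, and let $P_{r,\epsilon}$ be a polynomial with $P_{r,\epsilon}(0)=0$ and $\|P_{r,\epsilon}-\Gamma_r\|_{L^\infty(0,\lambda_1)}<\epsilon$. Assume that $F^\delta$, $\delta\in(0,1)$, are bounded linear operators on $L^2(\mathbb{S}^{d-1})$ with $\|F^\delta-F\|<\delta$ as $\delta\to0$. Then $$\left|\,\|P_{r,\epsilon}(F^\delta_\#)\phi_z\|^2_{L^2(\mathbb{S}^{d-1})}-\|P_{r,\epsilon}(F_\#)\phi_z\|^2_{L^2(\mathbb{S}^{d-1})}\right|\le C(1+|\ln(\delta)|)\,\delta\quad\text{as }\delta\to0,$$ uniformly for $z$ in compact subsets of $\mathbb{R}^d$; that is, for every compact $A\subset\mathbb{R}^d$ there are constants $C>0$ and $\delta_0\in(0,1)$ such that the inequality holds for all $z\in A$ and all $\delta\in(0,\delta_0)$.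
   Context: Let $d\in\{2,3\}$ and let $k>0$ be fixed. $D\subset\mathbb{R}^d$ is a bounded open set (possibly composed of multiple simply connected regions) with $C^2$ boundary $\partial D$ and unit outward normal $\nu$. The refractive index $n$ satisfies $n\in L^\infty(D)$ (complex-valued), $n=1$ in $\mathbb{R}^d\setminus\overline{D}$, $\mathrm{supp}(n-1)=D$, and $\mathrm{Im}(n)\ge 0$ a.e. in $D$. The conductivity $\eta\in L^\infty(\partial D)$ (complex-valued) satisfies $\mathrm{Im}(\eta)\ge 0$ a.e. on $\partial D$. Subscripts $-$ and $+$ denote traces on $\partial D$ from the interior and the exterior of $D$, respectively, and $\partial_\nu\phi=\nu\cdot\nabla\phi$. It is assumed that $k$ is not a transmission eigenvalue, i.e. the problem $$\Delta\varphi+k^2n\varphi=0,\quad \Delta\phi+k^2\phi=0\ \text{ in }D,\qquad \varphi=\phi,\quad \partial_\nu\varphi=\partial_\nu\phi+\eta\phi\ \text{ on }\partial D$$ admits only the trivial solution in $L^2(D)\times L^2(D)$. It is known that under this assumption the far-field operator $F$ below is injective with dense range. Scattering problem. For $\hat y\in\mathbb{S}^{d-1}$ let $u^i(x,\hat y)=e^{\mathrm{i}kx\cdot\hat y}$. The scattered field $u^s(\cdot,\hat y)\in H^1_{loc}(\mathbb{R}^d)$ is the unique solution of $$\Delta u^s+k^2n u^s=k^2(1-n)u^i \text{ in } \mathbb{R}^d\setminus\partial D,\quad u^s_- - u^s_+=0,\quad \partial_\nu u^s_- -\partial_\nu u^s_+=\eta(u^s+u^i)\text{ on }\partial D,$$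 with the Sommerfeld radiation condition $\partial_r u^s-\mathrm{i}ku^s=\mathcal{O}(r^{-(d+1)/2})$ as $r=|x|\to\infty$, uniformly in $\hat x=x/|x|$ (in this condition $r$ denotes $|x|$; in the claim $r$ is the iteration number). Its far-field pattern $u^\infty(\hat x,\hat y)$ is defined by $u^s(x,\hat y)=\gamma\frac{e^{\mathrm{i}k|x|}}{|x|^{(d-1)/2}}\{u^\infty(\hat x,\hat y)+\mathcal{O}(1/|x|)\}$ as $|x|\to\infty$, uniformly in $\hat x$, with $\gamma=e^{\mathrm{i}\pi/4}/\sqrt{8\pi k}$ if $d=2$ and $\gamma=1/(4\pi)$ if $d=3$. The far-field operator $F:L^2(\mathbb{S}^{d-1})\to L^2(\mathbb{S}^{d-1})$, $(Fg)(\hat x)=\int_{\mathbb{S}^{d-1}}u^\infty(\hat x,\hat y)g(\hat y)\,ds(\hat y)$, is compact. Operators $F_\#$ and $F^\delta_\#$. For a bounded operator $B$ on $L^2(\mathbb{S}^{d-1})$, $B_\#=|\mathrm{Re}(B)|+|\mathrm{Im}(B)|$, where $\mathrm{Re}(B)=\frac12(B+B^* )$, $\mathrm{Im}(B)=\frac{1}{2\mathrm{i}}(B-B^* )$, and the absolute value of a self-adjoint operator is defined via its spectral (eigenvalue) decomposition. $F_\#$ is self-adjoint, compact and positive, with largest eigenvalue $\lambda_1>0$. $F^\delta$ is the perturbed (noisy) far-field operator and $F^\delta_\#=(F^\delta)_\#$. Filter function. $\Gamma_r(t)=\frac{1-(1-\beta t)^r}{\sqrt t}$ for $t>0$ and $\Gamma_r(0)=0$.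 For a polynomial $P$ and a bounded operator $B$, $P(B)$ denotes the polynomial evaluated at $B$. For $z\in\mathbb{R}^d$, $\phi_z\in L^2(\mathbb{S}^{d-1})$ is $\phi_z(\hat y)=e^{-\mathrm{i}kz\cdot\hat y}$. $\|\cdot\|$ without subscript is the operator norm on $L^2(\mathbb{S}^{d-1})$. *)

(* Defs.v *)
From HB Require Import structures.
From mathcomp Require Import all_boot all_order all_algebra.
From mathcomp Require Import complex.
From mathcomp Require Import all_classical all_reals all_analysis.

Set Implicit Arguments.
Unset Strict Implicit.
Unset Printing Implicit Defensive.
Import Order.TTheory GRing.Theory Num.Theory.
Import numFieldNormedType.Exports.

Local Open Scope classical_set_scope.
Local Open Scope ring_scope.

(* A copy of [T] all of whose subsets are measurable, so that the library's
   [mu_ext] ranges over covers by arbitrary sets. *)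
Definition all_sets (T : Type) : Type := T.

Section all_sets_measurable.
Variable T : pointedType.
HB.instance Definition _ := Pointed.on (all_sets T).
HB.instance Definition _ := @isMeasurable.Build default_measure_display
  (all_sets T) (@discrete_measurable T) (@discrete_measurable0 T)
  (@discrete_measurableC T) (@discrete_measurableU T).
End all_sets_measurable.

Section cover_measure.
Local Open Scope ereal_scope.
Context {R : realType} {T : pointedType}.
Variable w : set T -> \bar R.

Definition weight0 (A : set T) : \bar R :=
  if `[< A = set0 >] then 0 else maxe 0 (w A).

(* inf { sum_k w (A_k) | X is covered by the sets A_k }; in the two instances
   below [w] is nonnegative on nonempty sets, so [maxe] has no effect. *)
Definition cover_measure : set T -> \bar R :=
  @mu_ext _ (all_sets T) R weight0.

Lemma weight00 : weight0 set0 = 0.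
Proof. by rewrite /weight0; case: asboolP. Qed.

Lemma weight0_ge0 A : 0 <= weight0 A.
Proof. by rewrite /weight0; case: asboolP => // _; rewrite le_max lexx. Qed.

HB.instance Definition _ := isOuterMeasure.Build R T cover_measure
  (@mu_ext0 _ (all_sets T) R _ weight00 weight0_ge0)
  (@mu_ext_ge0 _ (all_sets T) R _ weight0_ge0)
  (@le_mu_ext _ (all_sets T) R weight0)
  (@mu_ext_sigma_subadditive _ (all_sets T) R _ weight0_ge0).

End cover_measure.

Section euclidean.
Context {R : realType} {d : nat}.
Implicit Types x y : 'rV[R]_d.

Definition dot x y : R := \sum_i x 0 i * y 0 i.
(* The library norm of ['rV[R]_d] is the maximum norm. *)
Definition enorm x : R := Num.sqrt (dot x x).
Definition eball (rho : R) : set 'rV[R]_d := [set x | enorm x < rho].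
Definition sphere : set 'rV[R]_d := [set x | enorm x = 1].

Definition box_weight (A : set 'rV[R]_d) : \bar R :=
  ereal_inf [set (\prod_i (c.2 0 i - c.1 0 i))%:E |
    c in [set c : 'rV[R]_d * 'rV[R]_d |
      (forall i, c.1 0 i <= c.2 0 i) /\
      A `<=` [set x | forall i, c.1 0 i <= x 0 i <= c.2 0 i]]].

Definition ediam (A : set 'rV[R]_d) : \bar R :=
  ereal_sup [set (enorm (c.1 - c.2))%:E |
    c in [set c : 'rV[R]_d * 'rV[R]_d | A c.1 /\ A c.2]].

Fixpoint unit_ball_volume (s : nat) : R :=
  match s with
  | 0 => 1
  | 1 => 2
  | s'.+2 => 2 * pi / s%:R * unit_ball_volume s'
  end.

Definition diam_weight (s : nat) (e : R) (A : set 'rV[R]_d) : \bar R :=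
  if (ediam A <= e%:E)%E
  then ((unit_ball_volume s / 2 ^+ s)%:E * (ediam A) ^+ s)%E else +oo%E.

Definition lebesgue_outer : set 'rV[R]_d -> \bar R := cover_measure box_weight.

(* Normalized so that, for s = d - 1, it is the surface measure on C^1
   hypersurfaces. *)
Definition hausdorff_outer (s : nat) (X : set 'rV[R]_d) : \bar R :=
  ereal_sup [set cover_measure (diam_weight s e) X | e in [set e : R | 0 < e]].

HB.instance Definition _ := OuterMeasure.on lebesgue_outer.

Section hausdorff_outer_measure.
Local Open Scope ereal_scope.
Variable s : nat.
Let H := hausdorff_outer s.

Let H_ub e X : (0 < e)%R -> cover_measure (diam_weight s e) X <= H X.
Proof. by move=> e0; apply: ereal_sup_ubound; exists e. Qed.

Let H0 : H set0 = 0.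
Proof.
apply/eqP; rewrite eq_le; apply/andP; split.
  by apply: ge_ereal_sup => _ [e _ <-]; rewrite outer_measure0.
by apply: le_trans (H_ub set0 ltr01); rewrite outer_measure0.
Qed.

Let H_ge0 X : 0 <= H X.
Proof. by apply: le_trans (H_ub X ltr01); exact: outer_measure_ge0. Qed.

Let H_le : {homo H : A B / A `<=` B >-> A <= B}.
Proof.
move=> A B AB; apply: ge_ereal_sup => _ [e e0 <-].
by apply: le_trans (H_ub B e0); exact: le_outer_measure.
Qed.

Let H_sub : sigma_subadditive H.
Proof.
move=> F; apply: ge_ereal_sup => _ [e e0 <-].
apply: le_trans (outer_measure_sigma_subadditive _ F) _.
apply: lee_nneseries => [i _ _|i _]; first exact: outer_measure_ge0.
exact: H_ub.
Qed.

HB.instance Definition _ := isOuterMeasure.Build R 'rV[R]_d (hausdorff_outer s)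
  H0 H_ge0 H_le H_sub.

End hausdorff_outer_measure.

End euclidean.

Section measures.
Context (R : realType) (d : nat).

Let lebesgue_om : {outer_measure set 'rV[R]_d -> \bar R} := lebesgue_outer.
Let hausdorff_om : {outer_measure set 'rV[R]_d -> \bar R} :=
  hausdorff_outer d.-1.

(* Both measures live on the sigma-algebras of Caratheodory-measurable sets, which
   contain the Borel sets. *)
Definition lebesgue :
    {measure set (caratheodory_type lebesgue_om) -> \bar R} := lebesgue_om.

Definition surface :
    {measure set (caratheodory_type hausdorff_om) -> \bar R} := hausdorff_om.

End measures.

Local Open Scope complex_scope.
Import Normc.

Section operators.
Context {R : realType} {T : Type}.

Definition operator := (T -> R[i]) -> (T -> R[i]).
Implicit Types A B : operator.

Definition op_sub A B : operator := fun f x => A f x - B f x.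

Definition op_poly (P : {poly R[i]}) A : operator :=
  fun f x => \sum_(j < size P) P`_j * iter j A f x.

(* With [As] the adjoint of [A]. *)
Definition op_re A As : operator :=
  fun f x => (2%:R)^-1 * (A f x + As f x).
Definition op_im A As : operator :=
  fun f x => (2%:R * 'i)^-1 * (A f x - As f x).

End operators.

Arguments operator : clear implicits.

Section complex_L2.
Context {R : realType} {disp : measure_display} {T : measurableType disp}.
Variables (mu : {measure set T -> \bar R}) (D : set T).
Implicit Types f g : T -> R[i].

Definition ae_on (P : T -> Prop) := \forall x \ae mu, D x -> P x.

Definition cmeasurable f :=
  measurable_fun D (fun x => complex.Re (f x)) /\
  measurable_fun D (fun x => complex.Im (f x)).

Definition cint f : R[i] :=
  Rintegral mu D (fun x => complex.Re (f x)) +i*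
  Rintegral mu D (fun x => complex.Im (f x)).

Definition L2 f :=
  cmeasurable f /\ (\int[mu]_(x in D) (normc (f x) ^+ 2)%:E < +oo)%E.

Definition Linfty f :=
  cmeasurable f /\ exists M : R, ae_on (fun x => normc (f x) <= M).

Definition L2norm f : R :=
  Num.sqrt (Rintegral mu D (fun x => normc (f x) ^+ 2)).

Definition inner f g : R[i] := cint (fun x => f x * (g x)^*).

Implicit Types A B : operator R T.

Definition op_eq A B :=
  forall f, L2 f -> ae_on (fun x => A f x = B f x).

Definition op_le A (M : R) := forall f, L2 f -> L2norm (A f) <= M * L2norm f.

(* Elements of L^2 are square-integrable functions up to equality a.e. on [D];
   an operator acts on representatives.  Linearity and boundedness together
   force it to respect equality a.e. *)
Definition bounded_operator A :=
  [/\ forall f, L2 f -> L2 (A f),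
      forall (a : R[i]) f g, L2 f -> L2 g ->
        ae_on (fun x => A (fun y => a * f y + g y) x = a * A f x + A g x) &
      exists M : R, op_le A M].

Definition opnorm A : R :=
  sup [set L2norm (A f) | f in [set f | L2 f /\ L2norm f <= 1]].

Definition adjoint A As :=
  bounded_operator As /\
  forall f g, L2 f -> L2 g -> inner (A f) g = inner f (As g).

(* A resolution of the identity supported in [[a, b]]: increasing, strongly
   right-continuous orthogonal projections from 0 at [a] to 1 at [b]. *)
Definition spectral_family (a b : R) (E : R -> operator R T) :=
  (forall t, bounded_operator (E t)) /\
  [/\ forall t f g, L2 f -> L2 g -> inner (E t f) g = inner f (E t g),
      forall s t, op_eq (fun f => E s (E t f)) (E (Num.min s t)),
      forall t f, L2 f ->
        L2norm (fun x => E s f x - E t f x) @[s --> t^'+] --> (0 : R),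
      op_eq (E a) (fun _ _ => 0) &
      op_eq (E b) id].

(* A = \int phi dE, as a limit in operator norm of Riemann-Stieltjes sums over
   tagged partitions of an interval containing [[a, b]]. *)
Definition spectral_integral (a b : R) (E : R -> operator R T) (phi : R -> R) A :=
  forall e : R, 0 < e -> exists2 eta : R, 0 < eta &
    forall (N : nat) (t xi : nat -> R),
      t 0%N <= a -> b <= t N ->
      (forall j, (j < N)%N ->
        [/\ t j <= xi j, xi j <= t j.+1 & t j.+1 - t j < eta]) ->
      op_le (fun f x => A f x -
        \sum_(j < N) (phi (xi j))%:C * (E (t j.+1) f x - E (t j) f x)) e.

(* [absA] = |A| for the self-adjoint operator [A].  A perturbed far-field operator
   need not be compact, hence a spectral resolution; for compact [A] it is the
   eigenvalue decomposition. *)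
Definition is_absop A absA :=
  bounded_operator absA /\
  exists a b (E : R -> operator R T),
    [/\ spectral_family a b E, spectral_integral a b E id A &
        spectral_integral a b E (fun t => `|t|) absA].

(* [S] = |Re B| + |Im B| *)
Definition is_sharp B S :=
  bounded_operator S /\
  exists Bs absRe absIm,
    [/\ adjoint B Bs,
        is_absop (op_re B Bs) absRe,
        is_absop (op_im B Bs) absIm &
        op_eq S (fun f x => absRe f x + absIm f x)].

Definition eigenvalue_of A (lam : R) :=
  exists f, [/\ L2 f, L2norm f != 0 & ae_on (fun x => A f x = lam%:C * f x)].

Definition largest_eigenvalue A (lam : R) :=
  eigenvalue_of A lam /\ forall lam', eigenvalue_of A lam' -> lam' <= lam.

End complex_L2.

Section sobolev.
Context {R : realType} {d : nat}.
Local Notation E := 'rV[R]_d.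
Local Notation leb := (lebesgue R d).
Local Notation surf := (surface R d).
Implicit Types (D O : set E) (u w h : E -> R[i]) (psi : E -> R).

Definition partial (i : 'I_d) psi : E -> R :=
  fun x => derive psi x (delta_mx 0 i).

Definition laplacian psi : E -> R :=
  fun x => \sum_i partial i (partial i psi) x.

Definition grad psi (x : E) : E := \row_i partial i psi x.

Fixpoint Cm (m : nat) psi : Prop :=
  continuous psi /\
  (if m is m'.+1
   then forall i, (forall x, derivable psi x (delta_mx 0 i)) /\
                  Cm m' (partial i psi)
   else True).

Definition test_function O psi :=
  (forall m, Cm m psi) /\
  exists K : set E, [/\ compact K, K `<=` O & forall x, ~ K x -> psi x = 0].

Definition boundary D : set E := closure D `\` D°.

Definition exterior D : set E := ~` closure D.

(* [rho] is defined on the whole space: a local C^2 function can be cut off. *)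
Definition local_defining_function D (p : E) (rho : E -> R) :=
  [/\ Cm 2 rho, grad rho p != 0 & \forall x \near p, D x <-> rho x < 0].

Definition C2_boundary D :=
  forall p, boundary D p -> exists rho, local_defining_function D p rho.

Definition outward_unit_normal D (nu : E -> E) :=
  forall p, boundary D p -> exists rho,
    local_defining_function D p rho /\
    nu p = (enorm (grad rho p))^-1 *: grad rho p.

Definition normal_derivative (nu : E -> E) psi : E -> R :=
  fun x => dot (nu x) (grad psi x).

Definition essential_support (f : E -> R[i]) : set E :=
  [set x | forall U, open_nbhs x U -> ~ ae_on leb U (fun y => f y = 0)].

Definition weak_gradient O u (G : 'I_d -> E -> R[i]) :=
  forall psi, test_function O psi -> forall i,
    cint leb O (fun x => u x * (partial i psi x)%:C) =
    - cint leb O (fun x => G i x * (psi x)%:C).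

Definition weak_laplacian O u w :=
  forall psi, test_function O psi ->
    cint leb O (fun x => u x * (laplacian psi x)%:C) =
    cint leb O (fun x => w x * (psi x)%:C).

(* u is in H^1(O), with gradient G *)
Definition H1 O u (G : 'I_d -> E -> R[i]) :=
  [/\ L2 leb O u, forall i, L2 leb O (G i) & weak_gradient O u G].

(* u is in H^1_loc(R^d), with gradient G *)
Definition H1_loc u (G : 'I_d -> E -> R[i]) :=
  forall rho, 0 < rho -> H1 (eball rho) u G.

(* [h] is the trace on the part [S] of the boundary of [O] of u in H^1(O): the
   limit in L^2(S) of the restrictions of C^1 functions converging to u in
   H^1(O). *)
Definition H1_trace O (S : set E) u (G : 'I_d -> E -> R[i]) h :=
  L2 surf S h /\
  exists vr vi : nat -> E -> R,
    let v j x := vr j x +i* vi j x in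
    (forall j, Cm 1 (vr j) /\ Cm 1 (vi j)) /\
    [/\ L2norm leb O (fun x => v j x - u x) @[j --> \oo] --> (0 : R),
        forall i, L2norm leb O (fun x =>
          (partial i (vr j) x +i* partial i (vi j) x) - G i x)
          @[j --> \oo] --> (0 : R) &
        L2norm surf S (fun x => v j x - h x) @[j --> \oo] --> (0 : R)].

(* \int_O (grad u . grad psi + (Laplacian u) psi), with [G] and [w] the gradient
   and the Laplacian of u in O.  By Green's formula this is the pairing of the
   normal derivative of u, with the normal pointing out of O, against psi. *)
Definition conormal O (G : 'I_d -> E -> R[i]) w psi : R[i] :=
  cint leb O (fun x =>
    (\sum_i G i x * (partial i psi x)%:C) + w x * (psi x)%:C).

(* Trace on the boundary of D of u in L^2(D) whose Laplacian [w] is in L^2(D),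
   by transposition of Green's second identity. *)
Definition weak_trace D (nu : E -> E) u w h :=
  L2 surf (boundary D) h /\
  forall psi, Cm 2 psi -> (forall x, boundary D x -> psi x = 0) ->
    cint leb D (fun x => u x * (laplacian psi x)%:C - w x * (psi x)%:C) =
    cint surf (boundary D) (fun x => h x * (normal_derivative nu psi x)%:C).

(* Pairing of the normal derivative of such a u, with trace [h], against psi. *)
Definition weak_conormal D (nu : E -> E) u w h psi : R[i] :=
  cint surf (boundary D) (fun x => h x * (normal_derivative nu psi x)%:C) -
  cint leb D (fun x => u x * (laplacian psi x)%:C - w x * (psi x)%:C).

End sobolev.

Section scattering.
Context {R : realType} {d : nat}.
Local Notation E := 'rV[R]_d.
Local Notation leb := (lebesgue R d).
Local Notation surf := (surface R d).
Variables (k : R) (D : set E) (nu : E -> E) (n eta : E -> R[i]).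

(* D being open, supp(n - 1) = D is read up to closure. *)
Definition refractive_index :=
  [/\ Linfty leb D n,
      forall x, exterior D x -> n x = 1,
      essential_support (fun x => n x - 1) = closure D &
      ae_on leb D (fun x => 0 <= complex.Im (n x))].

Definition conductivity :=
  Linfty surf (boundary D) eta /\
  ae_on surf (boundary D) (fun x => 0 <= complex.Im (eta x)).

(* Boundary values of L^2 solutions are taken by transposition; the traces are
   required to be functions in L^2 of the boundary, so that the product of the
   merely bounded [eta] with the trace of [phi2] makes sense. *)
Definition transmission_solution (phi1 phi2 : E -> R[i]) :=
  [/\ L2 leb D phi1, L2 leb D phi2 &
    exists w1 w2 h1 h2 : E -> R[i],
      [/\ weak_laplacian D phi1 w1 /\ weak_laplacian D phi2 w2,
          ae_on leb D (fun x => w1 x + (k ^+ 2)%:C * n x * phi1 x = 0) /\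
          ae_on leb D (fun x => w2 x + (k ^+ 2)%:C * phi2 x = 0),
          weak_trace D nu phi1 w1 h1 /\ weak_trace D nu phi2 w2 h2,
          ae_on surf (boundary D) (fun x => h1 x = h2 x) &
          forall psi, Cm 2 psi ->
            weak_conormal D nu phi1 w1 h1 psi =
            weak_conormal D nu phi2 w2 h2 psi +
            cint surf (boundary D) (fun x => eta x * h2 x * (psi x)%:C)]].

Definition transmission_eigenvalue :=
  exists phi1 phi2, transmission_solution phi1 phi2 /\
    ~ (ae_on leb D (fun x => phi1 x = 0) /\ ae_on leb D (fun x => phi2 x = 0)).

Definition cis (t : R) : R[i] := cos t +i* sin t.

Definition incident (y x : E) : R[i] := cis (k * dot x y).

Definition radial_derivative (u : E -> R[i]) (x : E) : R[i] :=
  let v := (enorm x)^-1 *: x in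
  derive (fun x => complex.Re (u x)) x v +i*
  derive (fun x => complex.Im (u x)) x v.

Definition radially_derivable (u : E -> R[i]) (x : E) :=
  let v := (enorm x)^-1 *: x in
  derivable (fun x => complex.Re (u x)) x v /\
  derivable (fun x => complex.Im (u x)) x v.

(* The pointwise conditions at infinity, here and in [far_field_pattern], are on
   the representative [u] itself; by elliptic regularity a solution of the
   Helmholtz equation has a smooth one off the closure of D. *)
Definition sommerfeld (u : E -> R[i]) :=
  exists rho M : R, 0 < rho /\ forall x, rho <= enorm x ->
    radially_derivable u x /\
    normc (radial_derivative u x - 'i * k%:C * u x) <=
      M * enorm x `^ (- ((d%:R + 1) / 2)).

(* [hm] and [hp] are the interior and exterior traces of u on the boundary; [nu]
   points out of D, whence the sign of the exterior conormal. *)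
Definition scattered_field (y : E) (u : E -> R[i]) :=
  exists (G : 'I_d -> E -> R[i]) (w hm hp : E -> R[i]),
    [/\ H1_loc u G /\ weak_laplacian (~` boundary D) u w,
        ae_on leb (~` boundary D) (fun x =>
          w x + (k ^+ 2)%:C * n x * u x =
          (k ^+ 2)%:C * (1 - n x) * incident y x),
        [/\ H1_trace D (boundary D) u G hm,
            forall rho, closure D `<=` eball rho ->
              H1_trace (eball rho `\` closure D) (boundary D) u G hp &
            ae_on surf (boundary D) (fun x => hm x - hp x = 0)],
        forall psi, test_function setT psi ->
          conormal D G w psi - - conormal (exterior D) G w psi =
          cint surf (boundary D) (fun x =>
            eta x * (hm x + incident y x) * (psi x)%:C) &
        sommerfeld u].

Definition far_field_constant : R[i] :=
  if d == 2%N then cis (pi / 4) / (Num.sqrt (8 * pi * k))%:C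
  else ((4 * pi)^-1)%:C.

Definition far_field_pattern (u uinf : E -> R[i]) :=
  exists (rem : E -> R[i]) (rho M : R), 0 < rho /\
    forall x, rho <= enorm x ->
      u x = far_field_constant *
            (cis (k * enorm x) / (enorm x `^ ((d%:R - 1) / 2))%:C) *
            (uinf ((enorm x)^-1 *: x) + rem x) /\
      normc (rem x) <= M / enorm x.

Definition far_field_operator (F : operator R E) :=
  bounded_operator surf sphere F /\
  exists us uinf : E -> E -> R[i],
    [/\ forall y, sphere y -> scattered_field y (us y),
        forall y, sphere y -> far_field_pattern (us y) (uinf^~ y) &
        forall g, L2 surf sphere g -> ae_on surf sphere (fun x =>
          F g x = cint surf sphere (fun y => uinf x y * g y))].

Definition plane_wave (z y : E) : R[i] := cis (- (k * dot z y)).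

End scattering.

Definition Gamma_filter (R : realType) (beta : R) (r : nat) (t : R) : R :=
  if 0 < t then (1 - (1 - beta * t) ^+ r) / Num.sqrt t else 0.

Definition Linfty_dist (R : realType) (lam : R) (P : {poly R[i]})
    (f : R -> R) : \bar R :=
  Lnorm (mrestr (@lebesgue_measure R)
           (measurable_itv `]0, lam[ : measurable (`]0, lam[%classic : set R)))
    +oo%E (fun t => (normc (P.[t%:C] - (f t)%:C))%:E).

(* Main.v *)
Require Import Defs.
From HB Require Import structures.
From mathcomp Require Import all_boot all_order all_algebra.
From mathcomp Require Import complex ring lra.
From mathcomp Require Import all_classical all_reals all_analysis.
From mathcomp Require Import measurable_realfun.
Import Order.TTheory GRing.Theory Num.Theory.
Import numFieldNormedType.Exports.
Local Open Scope classical_set_scope.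
Local Open Scope ring_scope.
Set Implicit Arguments.
Unset Strict Implicit.
Unset Printing Implicit Defensive.

(** Why the estimate holds. The operator $B_\#$ is a sum of two absolute values
    of self-adjoint operators, and in operator norm the map $A \mapsto |A|$ is
    Lipschitz up to a logarithm: if $\|A\|, \|B\| \le M$ and $\|A-B\| \le \delta
    < 1$, then $\||A|-|B|\| \le C_M (1+|\ln\delta|)\delta$
    ([absop_perturbation]). Real and imaginary parts are perturbed by at most
    $\delta$, so $\|F^\delta_\# - F_\#\|$ is of order $(1+|\ln\delta|)\delta$
    ([sharp_perturbation]), and polynomials and squares of norms are Lipschitz
    on bounded sets ([sharp_poly_perturbation]). The functions $\phi_z$ have
    modulus one, hence all have the same norm ([plane_wave_norm]); this is what
    makes the constant uniform in $z$.

    The logarithm. On $[-1,1]$ the identity $|x| = x^2 (1-(1-x^2))^{-1/2}$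
    expands $|x|$ in powers of $1-x^2$, and $N$ terms of the expansion leave an
    error of order $N^{-1/2}$ ([abs_approximation]). For symmetric contractions
    $A$, $B$ at distance $\delta$ and $S = 1-A^2$, $T = 1-B^2$, the difference
    $S^n - T^n$ is of order $n^{1/2}\delta$ rather than $n\delta$
    ([iter_defect_perturbation]), because $\|A S^j\| \le (j+1)^{-1/2}$
    ([iter_defect_decay]). Summation by parts makes the coefficients of $S^n$ of
    order $n^{-3/2}$, so the truncated expansions of $|A|$ and $|B|$ differ by a
    harmonic sum times $\delta$ ([invsqrt_sum_perturbation]); taking $N$ of
    order $\delta^{-2}$ balances the two errors ([abs_perturbation]).

    Functional calculus is needed only for operators $\sum_i a_i P_i$ with
    finitely many orthogonal projections $P_i$: these are the Riemann sums of a
    spectral integral, and they approximate $A$ and $|A|$ in norm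
    ([absop_discretization]). The operators act on functions modulo null sets,
    so their lifts to the quotient of the square-integrable functions by the
    null functions ([L2_model_exists]) are linear maps of a real pre-Hilbert
    space, and identities almost everywhere become equalities.

    Finally $\phi_z$ has to be square-integrable on the sphere. Lipschitz
    functions are measurable for the Hausdorff measure by Carathéodory's
    criterion ([lipschitz_superlevel_measurable]), and the sphere in dimension
    $s+1$ is covered by a number of pieces of order $m^s$ whose diameter is of
    order $1/m$ ([cover_measure_sphere_le]). *)

(** * Polynomial approximation of the absolute value *)

Section absolute_value_approximation.
Variable R : realType.
Implicit Types (x y : R) (n m N : nat).

(** The Taylor coefficients $\binom{2n}{n} 4^{-n}$ of $(1-y)^{-1/2}$. *)
Fixpoint invsqrt_coef n : R :=
  if n is m.+1 then invsqrt_coef m * ((2 * m + 1)%:R / (2 * m + 2)%:R) else 1.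
Local Notation w := invsqrt_coef.

Lemma invsqrt_coef_gt0 n : 0 < w n.
Proof.
by elim: n => [|n IH] //=; rewrite mulr_gt0 // divr_gt0 // ltr0n addnS.
Qed.

Lemma invsqrt_coefS n : (2 * n + 2)%:R * w n.+1 = (2 * n + 1)%:R * w n.
Proof.
have n0 : (2 * n + 2)%:R != 0 :> R by rewrite pnatr_eq0 addnS.
by rewrite /= [LHS]mulrC -mulrA divfK // mulrC.
Qed.

Lemma invsqrt_coef_diff n : w n - w n.+1 = w n / (2 * n + 2)%:R.
Proof.
have n0 : (2 * n + 2)%:R != 0 :> R by rewrite pnatr_eq0 addnS.
apply: (mulfI n0); rewrite mulrBr invsqrt_coefS -mulrBl -natrB ?leq_add2l //.
by rewrite subnDl mul1r mulrC divfK.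
Qed.

(** The sequence $(2n+1) w_n^2$ decreases, since $(2n+1)(2n+3) \le (2n+2)^2$. *)
Lemma invsqrt_coef_le n : w n <= (Num.sqrt (2 * n + 1)%:R)^-1.
Proof.
have n1 k : 0 < (2 * k + 1)%:R :> R by rewrite ltr0n addnS.
suff H : w n ^+ 2 <= (2 * n + 1)%:R^-1.
  rewrite -(@ler_pXn2r _ 2) ?nnegrE ?invr_ge0 ?sqrtr_ge0 //.
    by rewrite exprVn sqr_sqrtr // ltW.
  exact: ltW (invsqrt_coef_gt0 n).
elim: n => [|n IH]; first by rewrite /= expr1n invr1.
rewrite /= exprMn; apply: le_trans (ler_wpM2r (exprn_ge0 _ _) IH) _.
  by rewrite divr_ge0.
have -> : (2 * n + 1)%:R = 2 * n%:R + 1 :> R by rewrite natrD natrM.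
have -> : (2 * n + 2)%:R = 2 * n%:R + 2 :> R by rewrite natrD natrM.
have -> : (2 * n.+1 + 1)%:R = 2 * n%:R + 3 :> R.
  by rewrite natrD natrM -addn1 natrD; ring.
have n0 : 0 <= n%:R :> R by [].
rewrite -subr_ge0.
set t : R := n%:R in n0 *.
suff -> : (2 * t + 3)^-1 - (2 * t + 1)^-1 * ((2 * t + 1) / (2 * t + 2)) ^+ 2 =
  ((2 * t + 3) * (2 * t + 2) ^+ 2)^-1.
  by rewrite invr_ge0 mulr_ge0 ?exprn_ge0 //; lra.
by field; apply/and3P; split; apply: lt0r_neq0; lra.
Qed.

(** Reversing the sum replaces the weight $i$ by $m-i$, and the two weights add
    up to $m$. *)
Lemma sum_weighted_convolution m :
  2 * \sum_(i < m.+1) i%:R * (w i * w (m - i)) =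
  m%:R * \sum_(i < m.+1) w i * w (m - i).
Proof.
rewrite mulr_natl mulr2n {2}(reindex_inj rev_ord_inj) -big_split mulr_sumr /=.
apply: eq_bigr => i _; have im : (i <= m)%N by rewrite -ltnS.
by rewrite subSS subKn // [X in _ + _ * X]mulrC -mulrDl -natrD subnKC.
Qed.

(** The square of $(1-y)^{-1/2}$ is the geometric series. The generating
    function $W$ of the coefficients satisfies $2(1-y)W' = W$, hence
    $(1-y)(W^2)' = W^2$; the induction reads this equation off coefficient by
    coefficient. *)
Lemma invsqrt_coef_convolution m : \sum_(i < m.+1) w i * w (m - i) = 1.
Proof.
elim: m => [|m IH]; first by rewrite big_ord1 /= mulr1.
have m0 : m.+1%:R != 0 :> R by rewrite pnatr_eq0.
apply: (mulfI m0); rewrite mulr1 -sum_weighted_convolution.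
rewrite big_ord_recl mul0r add0r mulr_sumr.
transitivity (\sum_(i < m.+1) (2 * i + 1)%:R * (w i * w (m - i))).
  apply: eq_bigr => i _; rewrite subSS mulrA -natrM.
  by rewrite [LHS]mulrA [RHS]mulrA -invsqrt_coefS mulnS addnC.
transitivity (2 * \sum_(i < m.+1) i%:R * (w i * w (m - i)) +
              \sum_(i < m.+1) w i * w (m - i)).
  rewrite mulr_sumr -big_split; apply: eq_bigr => i _ /=.
  by rewrite natrD natrM; ring.
by rewrite sum_weighted_convolution IH mulr1 -natr1.
Qed.

Definition invsqrt_sum N y : R := \sum_(n < N) w n * y ^+ n.

Lemma invsqrt_sum_ge0 N y : 0 <= y -> 0 <= invsqrt_sum N y.
Proof.
move=> y0; apply: sumr_ge0 => n _.
by rewrite mulr_ge0 ?exprn_ge0 // ltW ?invsqrt_coef_gt0.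
Qed.

Lemma geometric_sum m y : (1 - y) * \sum_(i < m) y ^+ i = 1 - y ^+ m.
Proof. by rewrite -[X in X - y ^+ _](expr1n R m) subrXX; congr (_ * _);
  apply: eq_bigr => i _; rewrite expr1n mul1r. Qed.

(** The square of the truncated series has the coefficients of the geometric
    series below degree $N$, and coefficients between $0$ and $1$ above. *)
Lemma invsqrt_sum_sqr N y : 0 <= y <= 1 ->
  1 - y ^+ N <= (1 - y) * invsqrt_sum N y ^+ 2 <= 1.
Proof.
move=> /andP[y0 y1].
pose p : {poly R} := \poly_(i < N) w i.
have pE : invsqrt_sum N y = p.[y] by rewrite horner_poly.
have sp : (size (p * p)%R <= N + N)%N.
  apply: leq_trans (size_polyMleq _ _) _; apply: leq_trans (leq_pred _) _.
  by rewrite leq_add // size_poly.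
have cE m : (p * p)`_m = \sum_(j < m.+1) p`_j * p`_(m - j) by rewrite coefM.
have p0 j : 0 <= p`_j.
  by rewrite coef_poly; case: ifP => // _; rewrite ltW ?invsqrt_coef_gt0.
have pw j : p`_j <= w j.
  by rewrite coef_poly; case: ifP => // _; rewrite ltW ?invsqrt_coef_gt0.
have c0 m : 0 <= (p * p)`_m by rewrite cE sumr_ge0 // => j _; rewrite mulr_ge0.
have c1 m : (p * p)`_m <= 1.
  by rewrite cE -(invsqrt_coef_convolution m) ler_sum // => j _; rewrite ler_pM.
have cN m : (m < N)%N -> (p * p)`_m = 1.
  move=> mN; rewrite cE -(invsqrt_coef_convolution m); apply: eq_bigr => j _.
  rewrite !coef_poly (leq_ltn_trans (leq_subr _ _) mN).
  by rewrite (leq_ltn_trans _ mN) // -ltnS.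
rewrite pE expr2 -hornerM (horner_coef_wide _ sp).
rewrite -geometric_sum.
apply/andP; split.
  rewrite ler_wpM2l ?subr_ge0 // big_split_ord /= -[leLHS]addr0 lerD //.
    by apply: ler_sum => i _; rewrite cN // mul1r.
  by apply: sumr_ge0 => i _; rewrite mulr_ge0 // exprn_ge0.
apply: (@le_trans _ _ ((1 - y) * \sum_(i < N + N) y ^+ i)).
  rewrite ler_wpM2l ?subr_ge0 //; apply: ler_sum => i _.
  by rewrite ler_piMl // exprn_ge0.
by rewrite geometric_sum gerBl exprn_ge0.
Qed.

(** With $y = 1 - x^2$ the truncated series for $y \mapsto (1-y)^{-1/2}$ turns
    $x^2$ into $|x|$; the error is at most $|x| (1-x^2)^N$, and
    $(2N+1) (1-y) y^{2N}$ is below the geometric sum, hence below $1$. *)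
Lemma abs_approximation N x : `|x| <= 1 ->
  `| `|x| - x ^+ 2 * invsqrt_sum N (1 - x ^+ 2) | <=
  (Num.sqrt (2 * N + 1)%:R)^-1.
Proof.
move=> x1; set y : R := 1 - x ^+ 2; set a : R := `|x|.
have a0 : 0 <= a by rewrite normr_ge0.
have xa : x ^+ 2 = a ^+ 2 by rewrite real_normK ?num_real.
have ya : 1 - y = a ^+ 2 by rewrite /y xa; ring.
have y01 : 0 <= y <= 1.
  by rewrite /y subr_ge0 gerBl xa exprn_ge0 // andbT exprn_ile1.
have /andP[lo hi] := invsqrt_sum_sqr N y01.
have s0 := invsqrt_sum_ge0 N (proj1 (andP y01)).
set s := invsqrt_sum N y in lo hi s0 *.
have yN0 : 0 <= y ^+ N by rewrite exprn_ge0 //; case/andP: y01.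
have yN1 : y ^+ N <= 1 by case/andP: y01 => ? ?; rewrite exprn_ile1.
rewrite ya in lo hi; rewrite xa.
have as1 : a * s <= 1.
  by rewrite -(@ler_pXn2r _ 2) ?nnegrE ?mulr_ge0 // exprMn expr1n.
have as2 : 1 - y ^+ N <= a * s.
  rewrite -(@ler_pXn2r _ 2) ?nnegrE ?mulr_ge0 ?subr_ge0 // exprMn.
  by apply: le_trans lo; rewrite expr2 ler_piMl ?subr_ge0 // gerBl.
have -> : a - a ^+ 2 * s = a * (1 - a * s) by ring.
rewrite ger0_norm ?mulr_ge0 ?subr_ge0 //.
apply: (@le_trans _ _ (a * y ^+ N)).
  by rewrite ler_wpM2l // lerBlDr addrC -lerBlDr.
have n0 : 0 < (2 * N + 1)%:R :> R by rewrite ltr0n addnS.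
rewrite -(@ler_pXn2r _ 2) ?nnegrE ?mulr_ge0 ?invr_ge0 ?sqrtr_ge0 //.
rewrite exprVn sqr_sqrtr ?(ltW n0) // exprMn -ya -exprM.
rewrite -[leRHS]mul1r ler_pdivlMr // mulrAC -mulrA.
apply: (@le_trans _ _ ((1 - y) * \sum_(i < 2 * N + 1) y ^+ i)).
  rewrite ler_wpM2l ?subr_ge0 ?(proj2 (andP y01)) //.
  have -> : (2 * N + 1)%:R * y ^+ (N * 2) = \sum_(i < 2 * N + 1) y ^+ (N * 2).
    by rewrite sumr_const card_ord mulr_natl.
  apply: ler_sum => i _; case/andP: y01 => ? ?.
  apply: ler_wiXn2l => //.
  by rewrite -ltnS; apply: leq_trans (ltn_ord i) _; rewrite mulnC addn1.
by rewrite geometric_sum gerBl exprn_ge0 //; case/andP: y01.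
Qed.

Lemma ler_sqrt_pinv n : (Num.sqrt n.+1%:R)^-1 <=
  2 * (Num.sqrt n.+1%:R - Num.sqrt n%:R) :> R.
Proof.
set b := Num.sqrt n.+1%:R; set a := Num.sqrt n%:R.
have b0 : 0 < b by rewrite sqrtr_gt0.
have a0 : 0 <= a by rewrite sqrtr_ge0.
have ab : a ^+ 2 = b ^+ 2 - 1.
  by rewrite !sqr_sqrtr ?ler0n // -natr1 addrK.
rewrite -[leLHS]mul1r ler_pdivrMr // -subr_ge0.
have -> : 2 * (b - a) * b - 1 = (b - a) ^+ 2 + (b ^+ 2 - 1 - a ^+ 2) by ring.
by rewrite ab subrr addr0 sqr_ge0.
Qed.

Lemma sum_inv_sqrt_le n :
  \sum_(j < n) (Num.sqrt j.+1%:R)^-1 <= 2 * Num.sqrt n%:R :> R.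
Proof.
elim: n => [|n IH]; first by rewrite big_ord0 mulr_ge0 ?sqrtr_ge0.
rewrite big_ord_recr /= (le_trans (lerD IH (ler_sqrt_pinv n))) //.
by rewrite mulrBr addrC subrK.
Qed.

Lemma harmonic_le_ln n : (0 < n)%N ->
  \sum_(j < n) j.+1%:R^-1 <= 1 + ln n%:R :> R.
Proof.
case: n => // n _; elim: n => [|n IH].
  by rewrite big_ord1 ln1 addr0 invr1.
rewrite big_ord_recr /=; apply: le_trans (lerD IH (lexx _)) _.
rewrite -addrA lerD2l.
have n1 : 0 < n.+1%:R :> R by [].
have n2 : 0 < n.+2%:R :> R by [].
suff : ln (n.+1%:R / n.+2%:R) <= - n.+2%:R^-1 :> R.
  by rewrite ln_div ?posrE // lerBlDl -lerBrDr.
have -> : n.+1%:R / n.+2%:R = 1 + (- n.+2%:R^-1) :> R.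
  rewrite -[X in X / _](addrK 1) natr1 mulrBl divff ?mul1r //.
apply: le_ln1Dx; rewrite ltrNl opprK invf_lt1 ?posrE //.
by rewrite (ltr_nat R 1).
Qed.

End absolute_value_approximation.

(** * Real vector spaces with a semi-inner product *)

Section semi_inner_product.
Variables (R : realType) (V : lmodType R).
Implicit Types (ip : V -> V -> R) (x y z : V).

Record semi_inner_product ip : Prop := SemiInnerProduct {
  ipC : forall x y, ip x y = ip y x;
  ip_linear : forall (a : R) x y z, ip (a *: x + y) z = a * ip x z + ip y z;
  ip_ge0 : forall x, 0 <= ip x x }.

Definition ipnorm ip x : R := Num.sqrt (ip x x).

Variable ip : V -> V -> R.
Hypothesis ipP : semi_inner_product ip.
Local Notation "<| x , y |>" := (ip x y) (format "<| x ,  y |>").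
Local Notation N := (ipnorm ip).

Lemma ip0l z : <|0, z|> = 0.
Proof. by have := ip_linear ipP 1 0 0 z; rewrite scale1r addr0 mul1r; lra. Qed.

Lemma ipDl x y z : <|x + y, z|> = <|x, z|> + <|y, z|>.
Proof. by rewrite -[x in LHS]scale1r (ip_linear ipP) mul1r. Qed.

Lemma ipZl a x z : <|a *: x, z|> = a * <|x, z|>.
Proof. by rewrite -[_ *: _ in LHS]addr0 (ip_linear ipP) ip0l addr0. Qed.

Lemma ipNl x z : <|- x, z|> = - <|x, z|>.
Proof. by rewrite -scaleN1r ipZl mulN1r. Qed.

Lemma ipBl x y z : <|x - y, z|> = <|x, z|> - <|y, z|>.
Proof. by rewrite ipDl ipNl. Qed.

Lemma ipDr x y z : <|z, x + y|> = <|z, x|> + <|z, y|>.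
Proof. by rewrite !(ipC ipP z) ipDl. Qed.

Lemma ipZr a x z : <|z, a *: x|> = a * <|z, x|>.
Proof. by rewrite !(ipC ipP z) ipZl. Qed.

Lemma ipBr x y z : <|z, x - y|> = <|z, x|> - <|z, y|>.
Proof. by rewrite !(ipC ipP z) ipBl. Qed.

Lemma ip_suml (I : finType) (F : I -> V) z :
  <|\sum_i F i, z|> = \sum_i <|F i, z|>.
Proof.
by elim/big_rec2: _ => [|i a b _ <-]; rewrite ?ip0l ?ipDl.
Qed.

Lemma ip_sumr (I : finType) (F : I -> V) z :
  <|z, \sum_i F i|> = \sum_i <|z, F i|>.
Proof. by rewrite (ipC ipP) ip_suml; apply: eq_bigr => i _; rewrite (ipC ipP). Qed.

Lemma ipnorm_ge0 x : 0 <= N x. Proof. exact: sqrtr_ge0. Qed.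

Lemma ipnorm_sqr x : N x ^+ 2 = <|x, x|>.
Proof. by rewrite sqr_sqrtr // (ip_ge0 ipP). Qed.

Lemma ipnorm0 : N 0 = 0. Proof. by rewrite /ipnorm ip0l sqrtr0. Qed.

Lemma ipnormZ a x : N (a *: x) = `|a| * N x.
Proof.
by rewrite /ipnorm ipZl ipZr mulrA -expr2 sqrtrM ?sqr_ge0 // sqrtr_sqr.
Qed.

Lemma ipnormN x : N (- x) = N x.
Proof. by rewrite -scaleN1r ipnormZ normrN1 mul1r. Qed.

Lemma ipnormBC x y : N (x - y) = N (y - x).
Proof. by rewrite -ipnormN opprB. Qed.

Lemma cauchy_schwarz x y : `|<|x, y|>| <= N x * N y.
Proof.
suff H : <|x, y|> ^+ 2 <= <|x, x|> * <|y, y|>.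
  rewrite -(@ler_pXn2r _ 2) ?nnegrE ?mulr_ge0 ?ipnorm_ge0 //.
  by rewrite exprMn !ipnorm_sqr real_normK ?num_real.
have quad s t : 0 <= s ^+ 2 * <|x, x|> + 2 * s * t * <|x, y|> + t ^+ 2 * <|y, y|>.
  have := ip_ge0 ipP (s *: x + t *: y).
  rewrite ipDl !ipDr !ipZl !ipZr (ipC ipP y x); congr (0 <= _); ring.
move: quad (ip_ge0 ipP x); set a := <|x, x|>; set b := <|x, y|>.
set c := <|y, y|> => quad; rewrite le_eqVlt => /predU1P[a0|a0].
  rewrite -a0 mul0r; have [->|b0] := eqVneq b 0; first by rewrite expr0n.
  have := quad (- (c + 1) / (2 * b)) 1; rewrite -a0.
  suff -> : (- (c + 1) / (2 * b)) ^+ 2 * 0 +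
      2 * (- (c + 1) / (2 * b)) * 1 * b + 1 ^+ 2 * c = -1.
    by rewrite oppr_ge0 ler10.
  by field.
rewrite -subr_ge0 -(pmulr_rge0 _ a0).
by have := quad (- b) a; congr (0 <= _); ring.
Qed.

Lemma ipnormD x y : N (x + y) <= N x + N y.
Proof.
rewrite -(@ler_pXn2r _ 2) ?nnegrE ?addr_ge0 ?ipnorm_ge0 //.
rewrite sqrrD !ipnorm_sqr ipDl !ipDr (ipC ipP y x).
have := le_trans (ler_norm _) (cauchy_schwarz x y).
by rewrite -mulr_natl; lra.
Qed.

Lemma ipnormB x y : N (x - y) <= N x + N y.
Proof. by rewrite -(ipnormN y) ipnormD. Qed.

Lemma ipnorm_dist_triangle z x y : N (x - y) <= N (x - z) + N (z - y).
Proof. by rewrite -{1}(subrK z x) -addrA ipnormD. Qed.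

Lemma ipnorm_sum (I : finType) (F : I -> V) : N (\sum_i F i) <= \sum_i N (F i).
Proof.
elim/big_rec2: _ => [|i a b _ IH]; first by rewrite ipnorm0.
exact: le_trans (ipnormD _ _) (lerD (lexx _) IH).
Qed.

End semi_inner_product.

(** * Powers of $1-A^2$ for a symmetric contraction *)

Section defect.
Variables (R : realType) (V : lmodType R).

Section linear_instances.
Variable A : {linear V -> V}.

(** For a symmetric contraction this is the square of its defect operator
    $(1-A^*A)^{1/2}$; the polynomials in it are the even polynomials in $A$. *)
Definition defect (f : V) : V := f - A (A f).

Fact defect_linear : linear defect.
Proof. by move=> a f g; rewrite /defect !linearP addrACA -scalerDr. Qed.

HB.instance Definition _ := GRing.isLinear.Build R V V *:%R defect defect_linear.

Fact iter_linear n : linear (iter n A).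
Proof. by move=> a f g; elim: n => //= n ->; rewrite linearP. Qed.

HB.instance Definition _ n :=
  GRing.isLinear.Build R V V *:%R (iter n A) (iter_linear n).
End linear_instances.

Variable ip : V -> V -> R.
Hypothesis ipP : semi_inner_product ip.
Local Notation N := (ipnorm ip).

Definition symmetric_operator (A : V -> V) := forall f g, ip (A f) g = ip f (A g).
Definition norm_le (M : R) (A : V -> V) := forall f, N (A f) <= M * N f.

Section contraction.
Variable A : {linear V -> V}.
Hypotheses (symA : symmetric_operator A) (contrA : norm_le 1 A).
Local Notation S := (defect A).

(** Writing $S = 1 - A^2$, the left side is $|f|^2 - |Af|^2 + |A^2f|^2$. *)
Lemma defect_pythagoras f : N (A f) ^+ 2 + N (S f) ^+ 2 <= N f ^+ 2.
Proof.
have : N (A (A f)) ^+ 2 <= N (A f) ^+ 2.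
  rewrite ler_pXn2r ?nnegrE ?ipnorm_ge0 //.
  by rewrite -[leRHS]mul1r contrA.
rewrite !(ipnorm_sqr ipP) /defect !(ipBl ipP) !(ipBr ipP) -(symA f) (symA (A f) f); lra.
Qed.

Lemma defect_contraction : norm_le 1 S.
Proof.
move=> f; rewrite mul1r -(@ler_pXn2r _ 2) ?nnegrE ?ipnorm_ge0 //.
by apply: le_trans (defect_pythagoras f); rewrite lerDr sqr_ge0.
Qed.

Lemma iter_defect_contraction n : norm_le 1 (iter n S).
Proof.
move=> f; elim: n => [|n IH] /=; first by rewrite mul1r.
by apply: le_trans (defect_contraction _) _; rewrite mul1r.
Qed.

Lemma defect_comm f : A (S f) = S (A f).
Proof. by rewrite /defect linearB. Qed.

Lemma iter_defect_comm n f : A (iter n S f) = iter n S (A f).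
Proof. by elim: n => //= n IH; rewrite defect_comm IH. Qed.

(** The numbers $|A S^i f|^2$ decrease in $i$, and by telescoping
    [defect_pythagoras] along the orbit of $S = 1 - A^2$ their sum is at most
    $|f|^2$. *)
Lemma iter_defect_decay n f :
  N (A (iter n S f)) <= (Num.sqrt n.+1%:R)^-1 * N f.
Proof.
have dec i : N (A (iter i.+1 S f)) ^+ 2 <= N (A (iter i S f)) ^+ 2.
  rewrite ler_pXn2r ?nnegrE ?ipnorm_ge0 //= defect_comm.
  by rewrite -[leRHS]mul1r defect_contraction.
have sum m : \sum_(i < m) N (A (iter i S f)) ^+ 2 + N (iter m S f) ^+ 2 <= N f ^+ 2.
  elim: m => [|m IH]; first by rewrite big_ord0 add0r.
  rewrite big_ord_recr /= -addrA; apply: le_trans IH.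
  by rewrite lerD2l defect_pythagoras.
have n0 : 0 < n.+1%:R :> R by [].
rewrite -(@ler_pXn2r _ 2) ?nnegrE ?mulr_ge0 ?invr_ge0 ?sqrtr_ge0 ?ipnorm_ge0 //.
rewrite exprMn exprVn (@sqr_sqrtr _ n.+1%:R) ?ler0n // ler_pdivlMl //.
apply: le_trans (sum n.+1).
apply: (@le_trans _ _ (\sum_(i < n.+1) N (A (iter i S f)) ^+ 2)); last first.
  by rewrite lerDl sqr_ge0.
rewrite mulr_natl -[X in _ *+ X](card_ord n.+1) -sumr_const.
apply: ler_sum => i _.
have {}dec k : N (A (iter (i + k) S f)) ^+ 2 <= N (A (iter i S f)) ^+ 2.
  by elim: k => [|k IH]; rewrite ?addn0 // addnS; exact: le_trans (dec _) IH.
by rewrite -{1}(subnKC (ltn_ord i : (i <= n)%N)).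
Qed.

End contraction.

Section perturbation.
Variables (A B : {linear V -> V}) (del : R).
Hypothesis del_ge0 : 0 <= del.
Hypotheses (symA : symmetric_operator A) (contrA : norm_le 1 A).
Hypotheses (symB : symmetric_operator B) (contrB : norm_le 1 B).
Hypothesis AB : norm_le del (fun f => A f - B f).
Local Notation S := (defect A).
Local Notation T := (defect B).

(** Telescoping gives $S^n - T^n = \sum_j S^j (S - T) T^{n-1-j}$ with
    $T - S = A (A - B) + (A - B) B$, so each term carries either $S^j A$ or
    $B T^{n-1-j}$, and both decay like the inverse square root of the exponent.
    The naive bound for the difference would be $2n$ times the perturbation. *)
Lemma iter_defect_perturbation n :
  norm_le (4 * Num.sqrt n%:R * del) (fun f => iter n S f - iter n T f).
Proof.
move=> f.
have tel : iter n S f - iter n T f =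
    \sum_(j < n) - iter j S
      (A (A (iter (n - j.+1) T f) - B (iter (n - j.+1) T f)) +
       (A (B (iter (n - j.+1) T f)) - B (B (iter (n - j.+1) T f)))).
  pose u j := iter j S (iter (n - j) T f).
  transitivity (u n - u 0%N); first by rewrite /u subnn subn0.
  rewrite -(telescope_sumr u) // big_mkord; apply: eq_bigr => j _.
  rewrite /u iterSr -[in X in _ - X](subnSK (ltn_ord j)) [iter (_.+1) T f]iterS.
  set g := iter _ T f.
  have SE : S g - T g = - (A (A g - B g) + (A (B g) - B (B g))).
    by rewrite (linearB A) subrKA opprB /defect opprB addrC subrKA.
  by rewrite -linearB SE linearN.
have del0 : 0 <= del * N f by rewrite mulr_ge0 // ipnorm_ge0.
rewrite tel.
apply: le_trans (ipnorm_sum ipP _) _.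
pose q i : R := (Num.sqrt i.+1%:R)^-1.
have q0 i : 0 <= q i by rewrite invr_ge0 sqrtr_ge0.
have qS : \sum_(j < n) q (n - j.+1)%N = \sum_(j < n) q j.
  by rewrite [RHS](reindex_inj rev_ord_inj).
apply: (@le_trans _ _ (\sum_(j < n) (q j + q (n - j.+1)%N) * (del * N f))).
  apply: ler_sum => j _; rewrite ipnormN // linearD mulrDl /=.
  set h := iter _ T f.
  have h1 : N h <= N f.
    by apply: le_trans (iter_defect_contraction symB contrB _ _) _; rewrite mul1r.
  have del1 k : N (A k - B k) <= del * N k := AB k.
  apply: le_trans (ipnormD ipP _ _) _; apply: lerD.
    rewrite -iter_defect_comm //.
    apply: le_trans (iter_defect_decay symA contrA _ _) _.
    by rewrite ler_wpM2l // (le_trans (del1 _)) // ler_wpM2l.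
  apply: le_trans (iter_defect_contraction symA contrA _ _) _; rewrite mul1r.
  apply: le_trans (del1 _) _; rewrite mulrCA.
  by rewrite ler_wpM2l // iter_defect_decay.
rewrite -mulr_suml big_split /= qS -mulr2n -mulr_natl -[leRHS]mulrA ler_wpM2r //.
have : \sum_(j < n) q j <= 2 * Num.sqrt n%:R := sum_inv_sqrt_le R n.
lra.
Qed.

(** Summation by parts trades $S^n - S^{n+1}$, whose coefficient is of order
    $n^{-1/2}$, for $S^{n+1}$ with a coefficient of order $n^{-3/2}$; against
    the growth $n^{1/2}$ of [iter_defect_perturbation] this leaves a harmonic
    sum. *)
Lemma invsqrt_sum_perturbation m :
  norm_le ((2 * (\sum_(j < m) j.+1%:R^-1) + 4) * del) (fun f =>
    \sum_(n < m) invsqrt_coef R n *: (iter n S f - iter n.+1 S f) -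
    \sum_(n < m) invsqrt_coef R n *: (iter n T f - iter n.+1 T f)).
Proof.
move=> f; pose w := invsqrt_coef R; pose D n := iter n S f - iter n T f.
have del0 : 0 <= del * N f by rewrite mulr_ge0 // ipnorm_ge0.
have D_le n : N (D n) <= 4 * Num.sqrt n%:R * (del * N f).
  by rewrite mulrA; exact: iter_defect_perturbation.
have w0 n : 0 < w n by exact: invsqrt_coef_gt0.
have w1 n : w n <= (Num.sqrt n.+1%:R)^-1.
  apply: le_trans (invsqrt_coef_le R n) _.
  rewrite lef_pV2 ?posrE ?sqrtr_gt0 ?ltr0n ?addnS // ler_wsqrtr //.
  by rewrite ler_nat addn0 ltnS leq_pmull.
have -> : \sum_(n < m) w n *: (iter n S f - iter n.+1 S f) -
    \sum_(n < m) w n *: (iter n T f - iter n.+1 T f) =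
    \sum_(n < m) w n *: (D n - D n.+1).
  rewrite -sumrB; apply: eq_bigr => n _; rewrite -scalerBr; congr (_ *: _).
  by rewrite /D !opprD !opprK addrACA.
set X := (X in N X).
have abel : N (X + w m *: D m) <= 2 * (\sum_(j < m) j.+1%:R^-1) * (del * N f).
  rewrite {}/X; elim: m => [|m IH].
    by rewrite !big_ord0 add0r /D subrr scaler0 ipnorm0 // mulr0 mul0r.
  rewrite !big_ord_recr /=.
  have -> : \sum_(i < m) w i *: (D i - D i.+1) + w m *: (D m - D m.+1) +
      w m.+1 *: D m.+1 =
      (\sum_(i < m) w i *: (D i - D i.+1) + w m *: D m) -
      (w m - w m.+1) *: D m.+1.
    rewrite (scalerBr (w m) (D m)) scalerBl; set X := \sum_(i < m) _.
    have abelian (a b c : V) : X + (a - b) + c = X + a - (b - c).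
      by rewrite opprB -!addrA [- b + c]addrC.
    exact: abelian.
  apply: le_trans (ipnormB ipP _ _) _; rewrite mulrDr mulrDl lerD //.
  rewrite ipnormZ // [w m - _]invsqrt_coef_diff.
  have wm0 : 0 <= w m / (2 * m + 2)%:R by rewrite divr_ge0 // ltW.
  rewrite (ger0_norm wm0); apply: le_trans (ler_wpM2l wm0 (D_le _)) _.
  rewrite mulrA ler_wpM2r //.
  have s0 : 0 < Num.sqrt m.+1%:R :> R by rewrite sqrtr_gt0.
  have m0 : 0 < m.+1%:R :> R by [].
  have -> : (2 * m + 2)%:R = 2 * m.+1%:R :> R by rewrite -natrM mulnS addnC.
  apply: le_trans (_ : (Num.sqrt m.+1%:R)^-1 / (2 * m.+1%:R) *
     (4 * Num.sqrt m.+1%:R) <= _).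
    by rewrite ler_wpM2r ?mulr_ge0 ?(ltW s0) // ler_wpM2r // invr_ge0 mulr_ge0.
  rewrite [leLHS](_ : _ = 2 / m.+1%:R) //.
  by field; apply/andP; split; exact: lt0r_neq0.
have -> : X = (X + w m *: D m) - w m *: D m by rewrite addrK.
apply: le_trans (ipnormB ipP _ _) _.
rewrite -mulrA mulrDl lerD // ipnormZ // gtr0_norm //.
apply: le_trans (ler_wpM2l (ltW (w0 m)) (D_le _)) _.
rewrite [leLHS]mulrA; apply: ler_wpM2r => //.
have s0 : 0 < Num.sqrt m.+1%:R :> R by rewrite sqrtr_gt0.
rewrite mulrCA ler_piMr //.
apply: le_trans (ler_wpM2r (sqrtr_ge0 _) (w1 m)) _.
by rewrite ler_pdivrMl // mulr1 ler_wsqrtr // ler_nat.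
Qed.

End perturbation.
End defect.

(** * The absolute value of an operator with finite spectrum *)

Section spectral_sums.
Variables (R : realType) (V : lmodType R) (ip : V -> V -> R).
Hypothesis ipP : semi_inner_product ip.
Local Notation N := (ipnorm ip).

Record resolution m (P : 'I_m -> {linear V -> V}) : Prop := Resolution {
  resolution_symm : forall i, symmetric_operator ip (P i);
  resolution_ortho : forall i j f, P i (P j f) = if i == j then P j f else 0;
  resolution_sum : forall f, \sum_i P i f = f }.

Section one_resolution.
Variables (m : nat) (P : 'I_m -> {linear V -> V}).
Hypothesis PP : resolution P.
Implicit Types phi psi : 'I_m -> R.

Definition spectral_sum phi f := \sum_i phi i *: P i f.

Fact spectral_sum_linear phi : linear (spectral_sum phi).
Proof.
move=> a f g; rewrite /spectral_sum scaler_sumr -big_split; apply: eq_bigr => i _.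
by rewrite linearP scalerDr !scalerA mulrC.
Qed.

HB.instance Definition _ phi :=
  GRing.isLinear.Build R V V *:%R (spectral_sum phi) (spectral_sum_linear phi).

Lemma spectral_proj phi i f : P i (spectral_sum phi f) = phi i *: P i f.
Proof.
rewrite linear_sum (bigD1 i) //= linearZ /= resolution_ortho // eqxx.
rewrite big1 ?addr0 // => j ji.
by rewrite linearZ /= resolution_ortho // eq_sym (negPf ji) scaler0.
Qed.

Lemma spectral_sumM phi psi f :
  spectral_sum phi (spectral_sum psi f) = spectral_sum (fun i => phi i * psi i) f.
Proof. by apply: eq_bigr => i _; rewrite spectral_proj scalerA. Qed.

Lemma spectral_sumB phi psi f :
  spectral_sum phi f - spectral_sum psi f = spectral_sum (fun i => phi i - psi i) f.
Proof. by rewrite -sumrB; apply: eq_bigr => i _; rewrite scalerBl. Qed.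

Lemma spectral_sum1 f : spectral_sum (fun=> 1) f = f.
Proof.
by rewrite -[RHS](resolution_sum PP); apply: eq_bigr => i _; rewrite scale1r.
Qed.

Lemma eq_spectral_sum phi psi f : phi =1 psi -> spectral_sum phi f = spectral_sum psi f.
Proof. by move=> E; apply: eq_bigr => i _; rewrite E. Qed.

Lemma spectral_sum_symm phi : symmetric_operator ip (spectral_sum phi).
Proof.
move=> f g; rewrite (ip_suml ipP) (ip_sumr ipP); apply: eq_bigr => i _.
by rewrite (ipZl ipP) (ipZr ipP) (resolution_symm PP).
Qed.

Lemma ipnorm_spectral_sum phi f :
  N (spectral_sum phi f) ^+ 2 = \sum_i phi i ^+ 2 * N (P i f) ^+ 2.
Proof.
rewrite (ipnorm_sqr ipP) (ip_suml ipP); apply: eq_bigr => i _.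
rewrite (ipZl ipP) (resolution_symm PP) spectral_proj (ipZr ipP) mulrA -expr2.
by rewrite (ipnorm_sqr ipP) (resolution_symm PP) resolution_ortho // eqxx.
Qed.

Lemma spectral_sum_norm_le phi (c : R) : 0 <= c ->
  (forall i f, N (P i f) != 0 -> `|phi i| <= c) -> norm_le ip c (spectral_sum phi).
Proof.
move=> c0 phic f.
rewrite -(@ler_pXn2r _ 2) ?nnegrE ?mulr_ge0 ?ipnorm_ge0 // exprMn.
rewrite -[in leRHS](spectral_sum1 f) !ipnorm_spectral_sum mulr_sumr.
apply: ler_sum => i _; rewrite expr1n mul1r.
have [->|Pf0] := eqVneq (N (P i f)) 0; first by rewrite expr0n !mulr0.
rewrite ler_wpM2r ?sqr_ge0 // -[leLHS]real_normK ?num_real //.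
by rewrite ler_pXn2r ?nnegrE //; exact: phic Pf0.
Qed.

(** A weight with nonzero projection is an eigenvalue, so the operator norm
    bounds it. A weight whose projection vanishes can be arbitrary, and the
    bound of [spectral_sum_norm_le] disregards it as well. *)
Lemma spectral_weight_le phi (M : R) : norm_le ip M (spectral_sum phi) ->
  forall i f, N (P i f) != 0 -> `|phi i| <= M.
Proof.
move=> phiM i f Pf0; have := phiM (P i f).
rewrite /spectral_sum (bigD1 i) //= resolution_ortho // eqxx big1 ?addr0.
  by rewrite (ipnormZ ipP) ler_pM2r // lt_def Pf0 ipnorm_ge0.
by move=> j ji; rewrite resolution_ortho // (negPf ji) scaler0.
Qed.

Lemma iter_defect_spectral_sum a n f :
  iter n (defect (spectral_sum a)) f = spectral_sum (fun i => (1 - a i ^+ 2) ^+ n) f.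
Proof.
elim: n => [|n IH]; first by rewrite /= -[LHS]spectral_sum1.
rewrite iterS IH /defect /= !spectral_sumM spectral_sumB.
apply: eq_spectral_sum => i; rewrite [_ ^+ n.+1]exprS; move: (_ ^+ n) => e; ring.
Qed.

Lemma abs_spectral_sum_approximation a k : norm_le ip 1 (spectral_sum a) ->
  norm_le ip (Num.sqrt (2 * k + 1)%:R)^-1 (fun f =>
    spectral_sum (fun i => `|a i|) f -
    \sum_(n < k) invsqrt_coef R n *: (iter n (defect (spectral_sum a)) f -
                                      iter n.+1 (defect (spectral_sum a)) f)).
Proof.
move=> a1 f.
have -> : \sum_(n < k) invsqrt_coef R n *:
    (iter n (defect (spectral_sum a)) f - iter n.+1 (defect (spectral_sum a)) f) =
    spectral_sum (fun i => a i ^+ 2 * invsqrt_sum k (1 - a i ^+ 2)) f.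
  under eq_bigr => n _ do
    rewrite !iter_defect_spectral_sum spectral_sumB /spectral_sum scaler_sumr.
  rewrite exchange_big; apply: eq_bigr => i _ /=.
  under eq_bigr => n _ do rewrite scalerA.
  rewrite -scaler_suml; congr (_ *: _); rewrite mulr_sumr.
  by apply: eq_bigr => n _; rewrite [_ ^+ n.+1]exprS; move: (_ ^+ n) => e; ring.
rewrite spectral_sumB; apply: spectral_sum_norm_le; first by rewrite invr_ge0.
move=> i g Pg; apply: abs_approximation; exact: spectral_weight_le Pg.
Qed.

End one_resolution.

Section two_resolutions.
Variables (m m' : nat) (P : 'I_m -> {linear V -> V}) (Q : 'I_m' -> {linear V -> V}).
Hypotheses (PP : resolution P) (QP : resolution Q).
Implicit Types (a : 'I_m -> R) (b : 'I_m' -> R).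

(** Both absolute values are replaced by the same polynomial of the operators.
    *)
Lemma abs_perturbation_contraction a b (del : R) k : 0 <= del ->
  norm_le ip 1 (spectral_sum P a) -> norm_le ip 1 (spectral_sum Q b) ->
  norm_le ip del (fun f => spectral_sum P a f - spectral_sum Q b f) ->
  norm_le ip (2 * (Num.sqrt (2 * k + 1)%:R)^-1 +
              (2 * (\sum_(j < k) j.+1%:R^-1) + 4) * del)
    (fun f => spectral_sum P (fun i => `|a i|) f - spectral_sum Q (fun i => `|b i|) f).
Proof.
move=> del0 a1 b1 ab f.
have Ha := abs_spectral_sum_approximation PP k a1 f.
have Hb := abs_spectral_sum_approximation QP k b1 f.
have Hab := invsqrt_sum_perturbation ipP del0 (spectral_sum_symm PP a) a1
  (spectral_sum_symm QP b) b1 ab k f.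
move: Ha Hb Hab; set pa := \sum_(n < k) _; set pb := \sum_(n < k) _.
rewrite [N (_ - pb)](ipnormBC ipP) => Ha Hb Hab.
apply: le_trans (ipnorm_dist_triangle ipP pa _ _) _.
apply: le_trans (lerD Ha (ipnorm_dist_triangle ipP pb _ _)) _.
apply: le_trans (lerD (lexx _) (lerD Hab Hb)) _.
by rewrite le_eqVlt; apply/orP; left; apply/eqP; ring.
Qed.

(** The number of terms is taken of order $\delta^{-2}$, which makes the
    truncation error of order $\delta$ and the harmonic sum of order
    $|\ln \delta|$. *)
Lemma abs_perturbation a b (M kap del : R) : 0 < M -> 0 <= kap -> 0 < del < 1 ->
  norm_le ip M (spectral_sum P a) -> norm_le ip M (spectral_sum Q b) ->
  norm_le ip (kap * del) (fun f => spectral_sum P a f - spectral_sum Q b f) ->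
  norm_le ip ((2 * M + 8 * kap) * ((1 + `|ln del|) * del))
    (fun f => spectral_sum P (fun i => `|a i|) f - spectral_sum Q (fun i => `|b i|) f).
Proof.
move=> M0 kap0 /andP[del0 del1] aM bM ab.
have MV0 : 0 <= M^-1 by rewrite invr_ge0 ltW.
have scale n (S : 'I_n -> {linear V -> V}) c f :
    spectral_sum S (fun i => c i / M) f = M^-1 *: spectral_sum S c f.
  by rewrite scaler_sumr; apply: eq_bigr => i _; rewrite scalerA mulrC.
have scale_abs n (S : 'I_n -> {linear V -> V}) c f :
    spectral_sum S (fun i => `|c i / M|) f =
    M^-1 *: spectral_sum S (fun i => `|c i|) f.
  rewrite -scale; apply: eq_spectral_sum => i.
  by rewrite normrM (ger0_norm MV0).
have scale_le n (S : 'I_n -> {linear V -> V}) c : norm_le ip M (spectral_sum S c) ->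
    norm_le ip 1 (spectral_sum S (fun i => c i / M)).
  move=> cM f; rewrite scale (ipnormZ ipP) ger0_norm // mul1r.
  by rewrite mulrC ler_pdivrMr // mulrC cM.
have abM : norm_le ip (kap * del / M) (fun f =>
    spectral_sum P (fun i => a i / M) f - spectral_sum Q (fun i => b i / M) f).
  move=> f; rewrite !scale -scalerBr (ipnormZ ipP) ger0_norm //.
  by rewrite [leRHS]mulrAC [leRHS]mulrC ler_wpM2l.
(* The number of terms lies between del^-2 and 2 del^-2. *)
pose k := (Num.truncn (del ^- 2)).+1.
have d2 : 1 <= del ^- 2.
  by rewrite invf_ge1 ?exprn_gt0 // exprn_ile1 // ltW.
have /andP[k1 k2] : (k.-1%:R <= del ^- 2 < k%:R) by apply: truncn_itv; lra.
have k3 : k%:R <= 2 * del ^- 2.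
  by rewrite -[k]prednK // -natr1 /=; lra.
have sk : (Num.sqrt (2 * k + 1)%:R)^-1 <= del.
  have k0 : 0 < (2 * k + 1)%:R :> R by rewrite ltr0n addnS.
  rewrite invf_ple ?posrE ?sqrtr_gt0 //.
  rewrite -(@ler_pXn2r _ 2) ?nnegrE ?invr_ge0 ?sqrtr_ge0 // ?(ltW del0) //.
  rewrite exprVn sqr_sqrtr ?ler0n //; apply: le_trans (ltW k2) _.
  by rewrite ler_nat addn1 leqW // leq_pmull.
have hk : \sum_(j < k) j.+1%:R^-1 <= 2 + 2 * `|ln del|.
  apply: le_trans (harmonic_le_ln R (ltn0Sn _)) _.
  have d2k : (0 : R) < 2 * del ^- 2 by lra.
  have : ln k%:R <= ln (2 * del ^- 2) :> R.
    by rewrite ler_ln ?posrE.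
  rewrite lnM ?posrE ?invr_gt0 ?exprn_gt0 // lnV ?posrE ?exprn_gt0 //.
  rewrite lnXn // (ler0_norm (ln_le0 (ltW del1))).
  have : ln 2 <= 1 :> R by have := @le_ln1Dx R 1; lra.
  by rewrite -mulr_natl; lra.
have kd0 : 0 <= kap * del / M by rewrite mulr_ge0 // mulr_ge0 // ltW.
move=> f; have := abs_perturbation_contraction k kd0 (scale_le _ _ _ aM)
  (scale_le _ _ _ bM) abM f.
rewrite !scale_abs -scalerBr (ipnormZ ipP) (ger0_norm MV0).
rewrite ler_pdivrMl //; move/le_trans; apply; rewrite mulrA.
apply: ler_wpM2r; first exact: ipnorm_ge0.
rewrite mulrDr mulrCA [X in _ + M * X](_ : _ =
  ((2 * (\sum_(j < k) j.+1%:R^-1) + 4) * (kap * del)) / M); last by rewrite !mulrA.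
rewrite [M * (_ / M)]mulrC divfK ?gt_eqF //.
have l0 : 0 <= `|ln del| by [].
rewrite [leRHS]mulrDl; apply: lerD.
  rewrite -[leRHS]mulrA ler_wpM2l // ler_wpM2l ?(ltW M0) //.
  by apply: le_trans sk _; rewrite ler_peMl ?(ltW del0) // lerDl.
apply: (@le_trans _ _ ((8 * (1 + `|ln del|)) * (kap * del))).
  by apply: ler_wpM2r; [rewrite mulr_ge0 // ltW | lra].
by rewrite le_eqVlt; apply/orP; left; apply/eqP; ring.
Qed.

End two_resolutions.
End spectral_sums.

(** * The space of square-integrable functions *)

Section submodule_type.
Variables (R : pzRingType) (W : lmodType R) (S : submodClosed W).

Record submodule := Submodule { submodule_val :> W; _ : submodule_val \in S }.

HB.instance Definition _ := [isSub for submodule_val].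
HB.instance Definition _ := [Choice of submodule by <:].
HB.instance Definition _ := [SubChoice_isSubLmodule of submodule by <:].

End submodule_type.

Section complex_L2_space.
Context {R : realType} {disp : measure_display} {T : measurableType disp}.
Variables (mu : {measure set T -> \bar R}) (D : set T).
Hypothesis mD : measurable D.
Local Open Scope complex_scope.
Implicit Types (f g h : T -> R[i]) (a c : R[i]).
Local Notation L2 := (L2 mu D).
Local Notation nrm := (L2norm mu D).
Local Notation Re := complex.Re.
Local Notation Im := complex.Im.
Local Notation normc := Normc.normc.

Lemma normc_sqr (z : R[i]) : normc z ^+ 2 = Re z ^+ 2 + Im z ^+ 2.
Proof. by case: z => x y; rewrite /= sqr_sqrtr // addr_ge0 // sqr_ge0. Qed.

Lemma normc_ge0 (z : R[i]) : 0 <= normc z.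
Proof. by case: z => x y; exact: sqrtr_ge0. Qed.

Lemma ReM (z w : R[i]) : Re (z * w) = Re z * Re w - Im z * Im w.
Proof. by case: z w => [? ?] [? ?]. Qed.

Lemma ImM (z w : R[i]) : Im (z * w) = Re z * Im w + Im z * Re w.
Proof. by case: z w => [? ?] [? ?]. Qed.

Lemma ReD (z w : R[i]) : Re (z + w) = Re z + Re w.
Proof. by case: z w => [? ?] [? ?]. Qed.

Lemma ImD (z w : R[i]) : Im (z + w) = Im z + Im w.
Proof. by case: z w => [? ?] [? ?]. Qed.

Lemma Re_mul_conj (z w : R[i]) : Re (z * w^*) = Re z * Re w + Im z * Im w.
Proof. by case: z w => [? ?] [? ?] /=; rewrite mulrN opprK. Qed.

Lemma normc_real (x : R) : normc x%:C = `|x|.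
Proof. by rewrite /= expr0n addr0 sqrtr_sqr. Qed.

Lemma cmeasurable_lin a f g : cmeasurable D f -> cmeasurable D g ->
  cmeasurable D (fun x => a * f x + g x).
Proof.
move=> [fr fi] [gr gi]; split.
  under eq_fun do rewrite ReD ReM.
  apply: measurable_funD => //; apply: measurable_funB;
    by apply: measurable_funM => //; exact: measurable_cst.
under eq_fun do rewrite ImD ImM.
apply: measurable_funD => //; apply: measurable_funD;
  by apply: measurable_funM => //; exact: measurable_cst.
Qed.

Definition re_prod f g : T -> R := fun x => Re (f x) * Re (g x) + Im (f x) * Im (g x).

Lemma measurable_re_prod f g : cmeasurable D f -> cmeasurable D g ->
  measurable_fun D (re_prod f g).
Proof.
by move=> [fr fi] [gr gi]; apply: measurable_funD; exact: measurable_funM.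
Qed.

Lemma normc_sqr_re_prod f x : normc (f x) ^+ 2 = re_prod f f x.
Proof. by rewrite normc_sqr. Qed.

Lemma re_prod_ge0 f x : 0 <= re_prod f f x.
Proof. by rewrite -normc_sqr_re_prod sqr_ge0. Qed.

Lemma L2P f : L2 f <-> cmeasurable D f /\ mu.-integrable D (EFin \o re_prod f f).
Proof.
split=> -[mf If]; split => //.
  apply/integrableP; split.
    by apply/measurable_EFinP; exact: measurable_re_prod.
  apply: le_lt_trans If; rewrite le_eqVlt; apply/orP; left; apply/eqP.
  apply: eq_integral => x _; rewrite normc_sqr_re_prod.
  by rewrite gee0_abs // lee_fin re_prod_ge0.
move/integrableP: If => [_]; apply: le_lt_trans.
rewrite le_eqVlt; apply/orP; left; apply/eqP.
apply: eq_integral => x _; rewrite normc_sqr_re_prod.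
by rewrite gee0_abs // lee_fin re_prod_ge0.
Qed.

Lemma integrable_re_prod f g : L2 f -> L2 g ->
  mu.-integrable D (EFin \o re_prod f g).
Proof.
move=> /L2P[mf If] /L2P[mg Ig].
apply: (le_integrable mD _ _ (integrableD mD If Ig)).
  by apply/measurable_EFinP; exact: measurable_re_prod.
move=> x _; rewrite [leRHS](_ : _ = `|(re_prod f f x + re_prod g g x)%:E|%E) //.
rewrite !abse_EFin lee_fin.
rewrite [leRHS]ger0_norm /re_prod; last first.
  exact: addr_ge0 (re_prod_ge0 _ _) (re_prod_ge0 _ _).
move: (Re _) (Im _) (Re _) (Im _) => p q r s.
rewrite ler_norml; apply/andP; split; rewrite -subr_ge0.
  rewrite (_ : _ - _ =
    ((p + r) ^+ 2 + (q + s) ^+ 2 + p ^+ 2 + q ^+ 2 + r ^+ 2 + s ^+ 2) / 2).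
    by rewrite divr_ge0 // !addr_ge0 // sqr_ge0.
  by field.
rewrite (_ : _ - _ =
  ((p - r) ^+ 2 + (q - s) ^+ 2 + p ^+ 2 + q ^+ 2 + r ^+ 2 + s ^+ 2) / 2).
  by rewrite divr_ge0 // !addr_ge0 // sqr_ge0.
by field.
Qed.

Lemma L2_lin a f g : L2 f -> L2 g -> L2 (fun x => a * f x + g x).
Proof.
move=> Lf Lg; apply/L2P; have [mf If] := (L2P f).1 Lf.
have [mg Ig] := (L2P g).1 Lg.
have ml := cmeasurable_lin a mf mg; split => //.
have /(integrableZl mD (2 * normc a ^+ 2)) If2 := If.
have /(integrableZl mD 2) Ig2 := Ig.
apply: (le_integrable mD _ _ (integrableD mD If2 Ig2)).
  by apply/measurable_EFinP; exact: measurable_re_prod.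
move=> x _.
rewrite [leRHS](_ : _ =
  `|(2 * normc a ^+ 2 * re_prod f f x + 2 * re_prod g g x)%:E|%E) //.
rewrite !abse_EFin lee_fin.
have bd0 : 0 <= 2 * normc a ^+ 2 * re_prod f f x + 2 * re_prod g g x.
  apply: addr_ge0; apply: mulr_ge0 (re_prod_ge0 _ _) => //.
  by rewrite mulr_ge0 // sqr_ge0.
rewrite (ger0_norm bd0) (ger0_norm (re_prod_ge0 _ _)).
rewrite normc_sqr /re_prod !ReD !ImD !ReM !ImM.
move: (Re (f x)) (Im (f x)) (Re (g x)) (Im (g x)) (Re a) (Im a) => r s u v p q.
rewrite -subr_ge0.
rewrite (_ : _ - _ = (p * r - q * s - u) ^+ 2 + (p * s + q * r - v) ^+ 2).
  by rewrite addr_ge0 // sqr_ge0.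
by ring.
Qed.

Lemma L2_0 : L2 (fun=> 0).
Proof.
apply/L2P; split; first by split; exact: measurable_cst.
apply: (eq_integrable mD _ _ _ (integrable0 mu D)) => x _ /=.
by rewrite /re_prod /= !mul0r addr0.
Qed.

Lemma L2_sub f g : L2 f -> L2 g -> L2 (fun x => f x - g x).
Proof.
move=> Lf Lg; have := L2_lin (-1) Lg Lf.
by rewrite (_ : (fun _ => _) = (fun x => f x - g x)) //; apply/funext => x;
  rewrite mulN1r addrC.
Qed.

Lemma L2_scale a f : L2 f -> L2 (fun x => a * f x).
Proof.
move=> Lf; have := L2_lin a Lf L2_0.
by rewrite (_ : (fun _ => _) = (fun x => a * f x)) //; apply/funext => x; rewrite addr0.
Qed.

Lemma L2_add f g : L2 f -> L2 g -> L2 (fun x => f x + g x).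
Proof.
move=> Lf Lg; have := L2_lin 1 Lf Lg.
by rewrite (_ : (fun _ => _) = (fun x => f x + g x)) //; apply/funext => x;
  rewrite mul1r.
Qed.

(** The real part of the inner product makes $L^2$ a real pre-Hilbert space
    with the same norm; it is all that estimates of norms need. *)
Definition rip f g : R := Re (inner mu D f g).

Lemma ripE f g : rip f g = Rintegral mu D (re_prod f g).
Proof. by apply: eq_Rintegral => x _; rewrite Re_mul_conj. Qed.

Lemma rip_linear (a : R) f g h : L2 f -> L2 g -> L2 h ->
  rip (fun x => a%:C * f x + g x) h = a * rip f h + rip g h.
Proof.
move=> Lf Lg Lh; rewrite !ripE.
have Ifh := integrable_re_prod Lf Lh; have Igh := integrable_re_prod Lg Lh.
transitivity (Rintegral mu D (fun x => a * re_prod f h x + re_prod g h x)).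
  apply: eq_Rintegral => x _; rewrite /re_prod ReD ImD ReM ImM /=; ring.
have Iafh : mu.-integrable D (EFin \o (fun x => a * re_prod f h x)).
  by apply: (eq_integrable mD _ _ _ (integrableZl mD a Ifh)) => x _ /=; rewrite EFinM.
by rewrite RintegralD // RintegralZl.
Qed.

Lemma ripC f g : rip f g = rip g f.
Proof.
rewrite !ripE; apply: eq_Rintegral => x _.
by rewrite /re_prod mulrC [X in _ + X]mulrC.
Qed.

Lemma L2norm_sqr f : nrm f ^+ 2 = rip f f.
Proof.
rewrite /L2norm sqr_sqrtr.
  by rewrite ripE; apply: eq_Rintegral => x _; rewrite normc_sqr.
by apply: Rintegral_ge0 => x _; rewrite sqr_ge0.
Qed.

Lemma L2norm_ge0 f : 0 <= nrm f. Proof. exact: sqrtr_ge0. Qed.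

Lemma L2norm_scale a f : L2 f -> nrm (fun x => a * f x) = normc a * nrm f.
Proof.
move=> Lf; rewrite -[normc a]ger0_norm ?normc_ge0 // -sqrtr_sqr -sqrtrM ?sqr_ge0 //.
congr (Num.sqrt _); have [_ If] := (L2P f).1 Lf.
have -> : Rintegral mu D (fun x => normc (f x) ^+ 2) = Rintegral mu D (re_prod f f).
  by apply: eq_Rintegral => x _; rewrite normc_sqr.
rewrite -RintegralZl //; apply: eq_Rintegral => x _.
by rewrite Normc.normcM exprMn (normc_sqr_re_prod f).
Qed.

Lemma rip_ae f g h : L2 f -> L2 g -> L2 h -> ae_on mu D (fun x => f x = g x) ->
  rip f h = rip g h.
Proof.
move=> Lf Lg Lh; rewrite /ae_on => fg; rewrite !ripE /Rintegral; congr fine.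
apply: ae_eq_integral => //.
- by apply/measurable_EFinP; apply: measurable_re_prod; [case: Lf|case: Lh].
- by apply/measurable_EFinP; apply: measurable_re_prod; [case: Lg|case: Lh].
- by apply: filterS fg => x /[apply] fgx; rewrite /re_prod /= fgx.
Qed.

(** The real Hilbert space $L^2$, with functions equal almost everywhere
    identified by the class map [cl]. *)
Record L2_model (V : lmodType R) (ip : V -> V -> R) (cl : (T -> R[i]) -> V) : Prop :=
 L2Model {
  model_ip : semi_inner_product ip;
  model_rip : forall f g, L2 f -> L2 g -> ip (cl f) (cl g) = rip f g;
  model_linear : forall (a : R) f g, L2 f -> L2 g ->
    cl (fun x => a%:C * f x + g x) = a *: cl f + cl g;
  model_surj : forall v, exists2 f, L2 f & cl f = v;
  model_definite : forall v, ip v v = 0 -> v = 0 }.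

Local Notation dual := ((T -> R[i]) -> R^o).

Let functional f : dual := fun g => if `[< L2 g >] then rip f g else 0.

Let is_functional : {pred dual} :=
  fun w => `[< exists2 f, L2 f & functional f = w >].

Let functional_linear (a : R) f g : L2 f -> L2 g ->
  functional (fun x => a%:C * f x + g x) = a *: functional f + functional g.
Proof.
move=> Lf Lg; apply/funext => h; rewrite /functional /GRing.scale /= /GRing.add /=.
case: asboolP => Lh; last by rewrite scaler0 addr0.
by rewrite rip_linear.
Qed.

Let is_functional_closed : submod_closed is_functional.
Proof.
split.
  apply/asboolP; exists (fun=> 0); first exact: L2_0.
  apply/funext => h; rewrite /functional; case: asboolP => // Lh.
  rewrite ripE (_ : re_prod _ _ = fun=> 0).
    by rewrite /Rintegral integral0.
  by apply/funext => x; rewrite /re_prod /= !mul0r addr0.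
move=> a v w /asboolP[f Lf <-] /asboolP[g Lg <-].
apply/asboolP; exists (fun x => a%:C * f x + g x); first exact: L2_lin.
exact: functional_linear.
Qed.

(** The Riesz map $f \mapsto \langle f, \cdot\rangle$ has the null functions as
    kernel, so its image is the quotient of the square-integrable functions by
    them. *)
Lemma L2_model_exists : exists (V : lmodType R) (ip : V -> V -> R)
  (cl : (T -> R[i]) -> V), L2_model ip cl.
Proof.
pose S : submodClosed (dual : lmodType R) :=
  HB.pack is_functional
    (GRing.isSubmodClosed.Build R (dual : lmodType R) is_functional
      is_functional_closed).
pose V : lmodType R := submodule S.
have Sfun f : L2 f -> functional f \in S by move=> Lf; apply/asboolP; exists f.
pose cl f : V := insubd (0 : V) (functional f).
have clE f : L2 f -> val (cl f) = functional f.
  by move=> Lf; rewrite val_insubd Sfun.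
have surj (v : V) : exists2 f, L2 f & cl f = v.
  have /asboolP[f Lf fv] := valP v.
  by exists f => //; apply: val_inj; rewrite clE.
pose rep v := projT1 (cid2 (surj v)).
have Lrep v : L2 (rep v) by rewrite /rep; case: cid2.
have clrep v : cl (rep v) = v by rewrite /rep; case: cid2.
have rip_rep f g : L2 f -> L2 g -> rip (rep (cl f)) g = rip f g.
  move=> Lf Lg; have := congr1 (fun v : V => val v g) (clrep (cl f)).
  by rewrite /= !clE // /functional; case: asboolP.
have cl_lin (a : R) f g : L2 f -> L2 g ->
    cl (fun x => a%:C * f x + g x) = a *: cl f + cl g.
  move=> Lf Lg; apply: val_inj; rewrite clE ?functional_linear //; last exact: L2_lin.
  by rewrite linearP /= !clE.
pose ip v w := rip (rep v) (rep w).
have ip_cl f g : L2 f -> L2 g -> ip (cl f) (cl g) = rip f g.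
  by move=> Lf Lg; rewrite /ip rip_rep // ripC rip_rep // ripC.
have ipP : semi_inner_product ip.
  split=> [v w|a u v w|v]; first by rewrite /ip ripC.
    rewrite -(clrep u) -(clrep v) -(clrep w) -cl_lin //.
    by rewrite !ip_cl ?rip_linear //; exact: L2_lin.
  by rewrite /ip -L2norm_sqr sqr_ge0.
have defi v : ip v v = 0 -> v = 0.
  move=> v0; rewrite -(clrep v); apply: val_inj; rewrite clE // raddf0.
  apply/funext => g; rewrite /functional; case: asboolP => // Lg.
  have := cauchy_schwarz ipP v (cl g).
  rewrite {1}/ipnorm v0 sqrtr0 mul0r normr_le0 => /eqP.
  by rewrite -{1}(clrep v) ip_cl // => ->.
by exists V, ip, cl; split.
Qed.

End complex_L2_space.

(** * Bounded operators, spectral resolutions and Riemann sums *)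

Section bounded_operators.
Context {R : realType} {disp : measure_display} {T : measurableType disp}.
Variables (mu : {measure set T -> \bar R}) (D : set T).
Hypothesis mD : measurable D.
Local Open Scope complex_scope.
Implicit Types (f g h : T -> R[i]) (A B : operator R T).
Local Notation L2 := (L2 mu D).
Local Notation nrm := (L2norm mu D).
Local Notation normc := Normc.normc.
Local Notation bounded := (bounded_operator mu D).
Local Notation op_le := (op_le mu D).

Variables (V : lmodType R) (ip : V -> V -> R) (cl : (T -> R[i]) -> V).
Hypothesis clP : L2_model mu D ip cl.
Let ipP : semi_inner_product ip := model_ip clP.
Local Notation N := (ipnorm ip).

Lemma model_norm f : L2 f -> N (cl f) = nrm f.
Proof.
move=> Lf; rewrite /ipnorm (model_rip clP) // -L2norm_sqr.
by rewrite sqrtr_sqr ger0_norm // L2norm_ge0.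
Qed.

Lemma model_add f g : L2 f -> L2 g -> cl (fun x => f x + g x) = cl f + cl g.
Proof.
move=> Lf Lg; rewrite -[cl f]scale1r -(model_linear clP) //.
by congr cl; apply/funext => x; rewrite mul1r.
Qed.

Lemma model_sub f g : L2 f -> L2 g -> cl (fun x => f x - g x) = cl f - cl g.
Proof.
move=> Lf Lg; rewrite addrC -[- _]scaleN1r -(model_linear clP) //.
by congr cl; apply/funext => x; rewrite rmorphN rmorph1 mulN1r addrC.
Qed.

Lemma model_scale (a : R) f : L2 f -> cl (fun x => a%:C * f x) = a *: cl f.
Proof.
move=> Lf; have L0 := L2_0 mu mD.
have cl0 : cl (fun=> 0) = 0.
  have := model_sub L0 L0; rewrite [RHS]subrr => <-.
  by congr cl; apply/funext => x; rewrite subr0.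
rewrite -[RHS]addr0 -cl0 -(model_linear clP) //.
by congr cl; apply/funext => x; rewrite addr0.
Qed.

Lemma model_ae f g : L2 f -> L2 g -> ae_on mu D (fun x => f x = g x) -> cl f = cl g.
Proof.
move=> Lf Lg fg; apply/eqP; rewrite -subr_eq0; apply/eqP.
have E h : L2 h -> ip (cl f - cl g) (cl h) = 0.
  by move=> Lh; rewrite (ipBl ipP) !(model_rip clP) // (rip_ae mD Lf Lg Lh fg) subrr.
apply: (model_definite clP); rewrite {2}(_ : cl f - cl g = cl (fun x => f x - g x)).
  by apply: E; exact: L2_sub.
by rewrite model_sub.
Qed.

Lemma model_sum n (c : 'I_n -> R) (F : 'I_n -> T -> R[i]) :
  (forall j, L2 (F j)) ->
  L2 (fun x => \sum_j (c j)%:C * F j x) /\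
  cl (fun x => \sum_j (c j)%:C * F j x) = \sum_j c j *: cl (F j).
Proof.
move=> LF; elim: n c F LF => [|n IH] c F LF.
  rewrite big_ord0 (_ : (fun _ => _) = (fun=> 0)); last first.
    by apply/funext => x; rewrite big_ord0.
  split; first exact: L2_0.
  have L0 := L2_0 mu mD.
  have := model_scale 0 L0; rewrite scale0r => <-.
  by congr cl; apply/funext => x; rewrite mulr0.
have [LS clS] := IH (fun j => c (lift ord0 j)) (fun j => F (lift ord0 j))
  (fun j => LF _).
rewrite big_ord_recl (_ : (fun _ => _) = (fun x => (c ord0)%:C * F ord0 x +
  \sum_(j < n) (c (lift ord0 j))%:C * F (lift ord0 j) x)); last first.
  by apply/funext => x; rewrite big_ord_recl.
by split; [exact: L2_lin | rewrite (model_linear clP) // clS].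
Qed.

Lemma L2norm_triangle f g : L2 f -> L2 g -> nrm (fun x => f x + g x) <= nrm f + nrm g.
Proof.
move=> Lf Lg; rewrite -!model_norm ?model_add //; last exact: L2_add.
exact: ipnormD.
Qed.

Lemma L2norm_triangleB f g : L2 f -> L2 g -> nrm (fun x => f x - g x) <= nrm f + nrm g.
Proof.
move=> Lf Lg; rewrite -!model_norm ?model_sub //; last exact: L2_sub.
exact: ipnormB.
Qed.

Lemma L2norm_sqr_dist f g : L2 f -> L2 g ->
  `|nrm f ^+ 2 - nrm g ^+ 2| <= nrm (fun x => f x - g x) * (nrm f + nrm g).
Proof.
move=> Lf Lg; rewrite subr_sqr normrM [X in _ * X]ger0_norm ?addr_ge0 ?L2norm_ge0 //.
rewrite ler_wpM2r ?addr_ge0 ?L2norm_ge0 //.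
rewrite -!model_norm ?model_sub //; last exact: L2_sub.
have := ipnormD ipP (cl f - cl g) (cl g); rewrite subrK => fg.
have := ipnormD ipP (cl g - cl f) (cl f); rewrite subrK (ipnormBC ipP) => gf.
by rewrite ler_norml; apply/andP; split; lra.
Qed.

Definition rep v := projT1 (cid2 (model_surj clP v)).

Lemma rep_L2 v : L2 (rep v). Proof. by rewrite /rep; case: cid2. Qed.

Lemma repK v : cl (rep v) = v. Proof. by rewrite /rep; case: cid2. Qed.

Definition lift_op A (v : V) : V := cl (A (rep v)).

Lemma op_le_ge0 A (M : R) : op_le A M -> exists2 M', 0 <= M' & op_le A M'.
Proof.
move=> AM; exists `|M| => // f Lf; apply: le_trans (AM f Lf) _.
by rewrite ler_wpM2r ?L2norm_ge0 // ler_norm.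
Qed.

Section one_operator.
Variable A : operator R T.
Hypothesis bA : bounded A.

Lemma bounded_L2 f : L2 f -> L2 (A f). Proof. by case: bA => H _ _; exact: H. Qed.

Lemma bounded_linear (a : R[i]) f g : L2 f -> L2 g ->
  ae_on mu D (fun x => A (fun y => a * f y + g y) x = a * A f x + A g x).
Proof. by case: bA => _ H _; exact: H. Qed.

Lemma bounded_norm : exists2 M : R, 0 <= M & op_le A M.
Proof. by case: bA => _ _ [M AM]; exact: op_le_ge0 AM. Qed.

Lemma model_op_linear (a : R) f g : L2 f -> L2 g ->
  cl (A (fun x => a%:C * f x + g x)) = a *: cl (A f) + cl (A g).
Proof.
move=> Lf Lg; rewrite -(model_linear clP); [|exact: bounded_L2..].
apply: model_ae; last exact: bounded_linear.
  by apply: bounded_L2; exact: L2_lin.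
by apply: L2_lin => //; exact: bounded_L2.
Qed.

(** Linearity almost everywhere and boundedness make an operator compatible with
    the identification of functions at distance zero. *)
Lemma model_op_eq f g : L2 f -> L2 g -> cl f = cl g -> cl (A f) = cl (A g).
Proof.
move=> Lf Lg fg; have Lh := L2_sub mD Lf Lg.
rewrite (_ : f = (fun x => 1%:C * (f x - g x) + g x)); last first.
  by apply/funext => x; rewrite rmorph1 mul1r subrK.
rewrite model_op_linear // scale1r -[RHS]add0r; congr (_ + _).
apply: (model_definite clP); rewrite -(ipnorm_sqr ipP) model_norm;
  last exact: bounded_L2.
have [M M0 AM] := bounded_norm.
suff -> : nrm (A (fun x => f x - g x)) = 0 by rewrite expr0n.
apply/eqP; rewrite eq_le L2norm_ge0 andbT; apply: le_trans (AM _ Lh) _.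
by rewrite -model_norm // model_sub // fg subrr ipnorm0 // mulr0.
Qed.

Lemma lift_op_cl f : L2 f -> lift_op A (cl f) = cl (A f).
Proof. by move=> Lf; apply: model_op_eq; rewrite ?repK //; exact: rep_L2. Qed.

Fact lift_op_linear : linear (lift_op A).
Proof.
move=> a v w; have := model_op_linear a (rep_L2 v) (rep_L2 w).
rewrite -lift_op_cl; last exact: L2_lin (rep_L2 _) (rep_L2 _).
by rewrite (model_linear clP) ?repK //; exact: rep_L2.
Qed.

Definition lift_lin : {linear V -> V} :=
  HB.pack (lift_op A) (GRing.isLinear.Build R V V *:%R (lift_op A) lift_op_linear).

Lemma lift_lin_cl f : L2 f -> lift_lin (cl f) = cl (A f).
Proof. exact: lift_op_cl. Qed.

Lemma bounded_scale (a : R) f : L2 f ->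
  nrm (A (fun x => a%:C * f x)) = `|a| * nrm (A f).
Proof.
move=> Lf; have Laf : L2 (fun x => a%:C * f x) by exact: L2_scale.
rewrite -!model_norm; [|exact: bounded_L2..].
by rewrite -!lift_lin_cl // model_scale // linearZ /= ipnormZ.
Qed.

Lemma op_le_opnorm : op_le A (opnorm mu D A).
Proof.
have [M M0 AM] := bounded_norm.
set S := [set nrm (A f) | f in [set f | L2 f /\ nrm f <= 1]].
have supS : has_ubound S.
  exists M => _ [f [Lf f1] <-]; apply: le_trans (AM _ Lf) _.
  by rewrite ler_piMr.
move=> f Lf; have [f0|f0] := eqVneq (nrm f) 0.
  by have := AM f Lf; rewrite f0 !mulr0.
have fp : 0 < nrm f by rewrite lt_def f0 L2norm_ge0.
rewrite -ler_pdivrMr // mulrC.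
have -> : (nrm f)^-1 * nrm (A f) = nrm (A (fun x => (nrm f)^-1%:C * f x)).
  by rewrite bounded_scale // ger0_norm // invr_ge0 ltW.
apply: ub_le_sup => //; exists (fun x => (nrm f)^-1%:C * f x) => //; split.
  exact: L2_scale.
rewrite (L2norm_scale mD) // normc_real ger0_norm ?invr_ge0 ?(ltW fp) //.
by rewrite mulVf.
Qed.

End one_operator.

Lemma bounded_sub A B : bounded A -> bounded B -> bounded (op_sub A B).
Proof.
move=> bA bB; split => [f Lf|a f g Lf Lg|].
- by apply: L2_sub => //; exact: bounded_L2.
- have := bounded_linear bB a Lf Lg; have := bounded_linear bA a Lf Lg.
  rewrite /ae_on; apply: filterS2 => x HA HB Dx; rewrite /op_sub HA // HB //.
  by rewrite mulrBr opprD addrACA.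
have [M M0 AM] := bounded_norm bA; have [M' M'0 BM] := bounded_norm bB.
exists (M + M') => f Lf; rewrite mulrDl.
apply: le_trans (L2norm_triangleB (bounded_L2 bA Lf) (bounded_L2 bB Lf)) _.
by rewrite lerD ?AM ?BM.
Qed.

Section discretization.
Variables (a b : R) (E : R -> operator R T).
Hypothesis specE : spectral_family mu D a b E.
Let bE : forall t, bounded (E t) := proj1 specE.

Let L t : {linear V -> V} := lift_lin (bE t).

Let L_symm t : symmetric_operator ip (L t).
Proof.
case: specE => _ [symE _ _ _ _] v w; rewrite -(repK v) -(repK w).
have Lv := rep_L2 v; have Lw := rep_L2 w.
rewrite !lift_lin_cl // !(model_rip clP) //; try exact: bounded_L2.
by rewrite /rip symE.
Qed.

Let L_comp s t v : L s (L t v) = L (Num.min s t) v.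
Proof.
case: specE => _ [_ compE _ _ _]; rewrite -(repK v); have Lv := rep_L2 v.
have LE u : L2 (E u (rep v)) by exact: bounded_L2.
rewrite [L t _]lift_lin_cl // [LHS]lift_lin_cl // [RHS]lift_lin_cl //.
by apply: model_ae => //; [exact: bounded_L2 | exact: compE].
Qed.

Let L_low t v : t <= a -> L t v = 0.
Proof.
case: specE => _ [_ _ _ lowE _] ta.
suff La u : L a u = 0 by rewrite -(min_idPl ta) -L_comp La linear0.
rewrite -(repK u); have Lu := rep_L2 u; rewrite lift_lin_cl //.
have L0 := L2_0 mu mD.
have <- : cl (fun=> 0) = 0.
  by have := model_scale 0 L0; rewrite scale0r => <-; congr cl; apply/funext => x;
    rewrite mulr0.
by apply: model_ae => //; [exact: bounded_L2 | exact: lowE].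
Qed.

Let L_high t v : b <= t -> L t v = v.
Proof.
case: specE => _ [_ _ _ _ highE] bt.
have Lb u : L b u = u.
  rewrite -(repK u); have Lu := rep_L2 u; rewrite lift_lin_cl //.
  by apply: model_ae => //; [exact: bounded_L2 | exact: highE].
by rewrite -{1}(Lb v) L_comp (min_idPr bt) Lb.
Qed.

(** The operators $E_t$ vanish for $t \le a$ and are the identity for $b \le t$,
    so the increments add up to the identity; they are mutually orthogonal
    because $E_s E_t = E_{\min(s,t)}$. *)
Lemma spectral_increments n (t : nat -> R) : {homo t : i j / (i <= j)%N >-> i <= j} ->
  t 0%N <= a -> b <= t n ->
  exists2 P : 'I_n -> {linear V -> V}, resolution ip P &
    forall (c : nat -> R) f, L2 f ->
      let g x := \sum_(j < n) (c j)%:C * (E (t j.+1) f x - E (t j) f x) in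
      L2 g /\ cl g = spectral_sum P (fun j => c j) (cl f).
Proof.
move=> tm ta tb.
pose P (i : 'I_n) : {linear V -> V} := (L (t i.+1) \- L (t i)).
have PE i v : P i v = L (t i.+1) v - L (t i) v by [].
exists P.
  split => [i v w|i j v|v].
  - by rewrite !PE (ipBl ipP) (ipBr ipP) !L_symm.
  - have minE k l : Num.min (t k) (t l) = t (minn k l).
      have [kl|lk] := leqP k l; first by rewrite min_l // tm.
      by rewrite min_r // tm // ltnW.
    rewrite !PE !(linearB (L _)) !L_comp !minE -(inj_eq val_inj).
    case: (ltngtP i j) => [ij|ji|ij].
    + rewrite (minn_idPl (ltnW ij : (i.+1 <= j.+1)%N)) (minn_idPl ij).
      by rewrite (minn_idPl (leqW (ltnW ij))) !subrr.
    + rewrite (minn_idPr (ltnW ji : (j.+1 <= i.+1)%N)) (minn_idPr ji).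
      by rewrite (minn_idPr (leqW (ltnW ji))) subrr.
    rewrite ij !minnn (minn_idPr (leqnSn j)) (minn_idPl (leqnSn j)).
    by rewrite subrr subr0.
  under eq_bigr => i _ do rewrite PE.
  rewrite -(big_mkord xpredT (fun i => L (t i.+1) v - L (t i) v)).
  rewrite (telescope_sumr (fun i => L (t i) v)) // L_high // L_low //.
  by rewrite subr0.
move=> c f Lf /=.
have LE u : L2 (E u f) by exact: bounded_L2.
have [] := @model_sum n (fun j => c j) (fun j x => E (t j.+1) f x - E (t j) f x).
  by move=> j; exact: L2_sub.
move=> Lg ->; split => //; apply: eq_bigr => j _ /=; congr (_ *: _).
by rewrite model_sub // -!lift_lin_cl.
Qed.

End discretization.

(** A partition of mesh below the two tolerances serves the operator and its
    absolute value at once. *)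
Lemma absop_discretization A absA (e : R) : 0 < e ->
  (forall f, L2 f -> L2 (A f)) -> is_absop mu D A absA ->
  exists (n : nat) (P : 'I_n -> {linear V -> V}) (c : 'I_n -> R),
    [/\ resolution ip P,
        forall f, L2 f -> N (cl (A f) - spectral_sum P c (cl f)) <= e * nrm f &
        forall f, L2 f ->
          N (cl (absA f) - spectral_sum P (fun i => `|c i|) (cl f)) <= e * nrm f].
Proof.
move=> e0 LA [bAbs [a [b [E [specE intA intAbs]]]]].
have [eta1 eta1p H1] := intA e e0; have [eta2 eta2p H2] := intAbs e e0.
pose h := Num.min eta1 eta2 / 2.
have h0 : 0 < h by rewrite divr_gt0 // lt_min eta1p.
have /andP[h1 h2] : (h < eta1) && (h < eta2).
  have hm : h < Num.min eta1 eta2.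
    by rewrite ltr_pdivrMr // ltr_pMr ?ltr1n // lt_min eta1p.
  by rewrite -lt_min.
pose t (j : nat) : R := a + h * j%:R.
pose n := (Num.truncn (`|b - a| / h)).+1.
have tm : {homo t : i j / (i <= j)%N >-> i <= j}.
  by move=> i j ij; rewrite lerD2l ler_wpM2l ?ler_nat // ltW.
have t0 : t 0%N <= a by rewrite /t mulr0 addr0.
have tn : b <= t n.
  have : `|b - a| / h < n%:R.
    by have /andP[] := @truncn_itv R (`|b - a| / h) (divr_ge0 (normr_ge0 _) (ltW h0)).
  rewrite ltr_pdivrMr // mulrC => ltn.
  by rewrite -lerBlDl; apply: le_trans (ler_norm _) (ltW ltn).
have [P PP HP] := spectral_increments specE tm t0 tn.
have mesh eta' : h < eta' -> forall j, (j < n)%N ->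
    [/\ t j <= t j, t j <= t j.+1 & t j.+1 - t j < eta'].
  move=> he j _; split => //; first exact: tm.
  by rewrite /t -natr1 mulrDr mulr1 opprD addrACA subrr add0r addrAC subrr add0r.
exists n, P, (fun i => t i); split => // f Lf.
  have [Lg clg] := HP t f Lf; rewrite -clg -model_sub //; last exact: LA.
  rewrite model_norm; last by apply: L2_sub => //; exact: LA.
  by apply: (H1 n t t t0 tn (mesh _ h1)).
have [Lg clg] := HP (fun j => `|t j|) f Lf.
rewrite -clg -model_sub //; last exact: bounded_L2.
rewrite model_norm; last by apply: L2_sub => //; exact: bounded_L2.
by apply: (H2 n t t t0 tn (mesh _ h2)).
Qed.

(** The map $A \mapsto |A|$ is Lipschitz up to a logarithm. Both operators are
    replaced by Riemann sums at distance $\delta$; these have norm at most $M+1$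
    and are at distance at most $3\delta$ from each other. *)
Lemma absop_perturbation A B absA absB (M del : R) : 0 <= M -> 0 < del < 1 ->
  (forall f, L2 f -> L2 (A f)) -> (forall f, L2 f -> L2 (B f)) ->
  is_absop mu D A absA -> is_absop mu D B absB ->
  op_le A M -> op_le B M -> op_le (op_sub A B) del ->
  op_le (op_sub absA absB) ((2 * M + 28) * ((1 + `|ln del|) * del)).
Proof.
move=> M0 /andP[d0 d1] LA LB absAP absBP AM BM AB.
have [n [P [c [PP Pc Pabs]]]] := absop_discretization d0 LA absAP.
have [m [Q [c' [QQ Qc Qabs]]]] := absop_discretization d0 LB absBP.
have norm_c k (X : 'I_k -> {linear V -> V}) x O : op_le O M ->
    (forall f, L2 f -> L2 (O f)) ->
    (forall f, L2 f -> N (cl (O f) - spectral_sum X x (cl f)) <= del * nrm f) ->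
    norm_le ip (M + 1) (spectral_sum X x).
  move=> OM LO Xx v; rewrite -(repK v); have Lv := rep_L2 v.
  have := ipnorm_dist_triangle ipP (cl (O (rep v))) (spectral_sum X x (cl (rep v))) 0.
  rewrite !subr0 (ipnormBC ipP) => /le_trans; apply.
  rewrite addrC mulrDl mul1r !model_norm //; last exact: LO.
  apply: lerD; first exact: OM.
  apply: le_trans (Xx _ Lv) _; rewrite ler_piMl ?L2norm_ge0 //; exact: ltW.
have PQ : norm_le ip (3 * del) (fun v => spectral_sum P c v - spectral_sum Q c' v).
  move=> v; rewrite -(repK v); have Lv := rep_L2 v.
  set u := cl (rep v); have uE : N u = nrm (rep v) by rewrite model_norm.
  have := AB _ Lv; rewrite /op_sub -model_norm; last first.
    by apply: L2_sub => //; [exact: LA|exact: LB].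
  rewrite model_sub; [|exact: LA|exact: LB] => AB'.
  apply: le_trans (ipnorm_dist_triangle ipP (cl (A (rep v))) _ _) _.
  apply: le_trans (lerD (lexx _) (ipnorm_dist_triangle ipP (cl (B (rep v))) _ _)) _.
  rewrite [N (spectral_sum P c u - _)](ipnormBC ipP).
  have := Pc _ Lv; have := Qc _ Lv; rewrite uE -/u; lra.
have M1 : 0 < M + 1 by lra.
have := abs_perturbation ipP PP QQ M1 (ler0n R 3) (introT andP (conj d0 d1))
  (norm_c _ _ _ _ AM LA Pc) (norm_c _ _ _ _ BM LB Qc) PQ.
move=> H f Lf.
have LabsA : L2 (absA f) by case: absAP => bAbs _; exact: bounded_L2.
have LabsB : L2 (absB f) by case: absBP => bAbs _; exact: bounded_L2.
rewrite -model_norm; last exact: L2_sub.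
rewrite model_sub // -!model_norm //.
have {}H := H (cl f); have := Pabs _ Lf; have := Qabs _ Lf.
rewrite -!model_norm // => HQ HP.
apply: le_trans
  (ipnorm_dist_triangle ipP (spectral_sum P (fun i => `|c i|) (cl f)) _ _) _.
apply: le_trans (lerD (lexx _) (ipnorm_dist_triangle ipP
  (spectral_sum Q (fun i => `|c' i|) (cl f)) _ _)) _.
rewrite [N (spectral_sum Q _ _ - _)](ipnormBC ipP).
apply: le_trans (lerD HP (lerD H HQ)) _.
rewrite addrCA -!mulrDl; apply: ler_wpM2r; first exact: ipnorm_ge0.
have : del <= (1 + `|ln del|) * del by rewrite ler_peMl ?(ltW d0) // lerDl.
move: (_ * del) => X; lra.
Qed.

End bounded_operators.

(** * Perturbation of $B_\#$ and of its polynomials *)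

Section sharp_perturbation.
Context {R : realType} {disp : measure_display} {T : measurableType disp}.
Variables (mu : {measure set T -> \bar R}) (D : set T).
Hypothesis mD : measurable D.
Local Open Scope complex_scope.
Implicit Types (f g h : T -> R[i]) (A B : operator R T).
Local Notation L2 := (L2 mu D).
Local Notation nrm := (L2norm mu D).
Local Notation normc := Normc.normc.
Local Notation bounded := (bounded_operator mu D).
Local Notation op_le := (op_le mu D).

Variables (V : lmodType R) (ip : V -> V -> R) (cl : (T -> R[i]) -> V).
Hypothesis clP : L2_model mu D ip cl.

(** With $g = (A-B)^* f$, one has $|g|^2 = \langle (A-B)g, f\rangle$. *)
Lemma adjoint_sub_le A As B Bs (M : R) : 0 <= M -> bounded A -> bounded B ->
  adjoint mu D A As -> adjoint mu D B Bs ->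
  op_le (op_sub A B) M -> op_le (op_sub As Bs) M.
Proof.
move=> M0 bA bB [bAs adjA] [bBs adjB] AB f Lf.
set g := op_sub As Bs f; have Lg : L2 g.
  by apply: L2_sub => //; exact: bounded_L2.
have LAB : L2 (op_sub A B g) by apply: L2_sub => //; exact: bounded_L2.
have ripA : rip mu D (A g) f = rip mu D g (As f) by rewrite /rip adjA.
have ripB : rip mu D (B g) f = rip mu D g (Bs f) by rewrite /rip adjB.
have sq : nrm g ^+ 2 = rip mu D (op_sub A B g) f.
  have LA := bounded_L2 bA Lg; have LB := bounded_L2 bB Lg.
  have LAs := bounded_L2 bAs Lf; have LBs := bounded_L2 bBs Lf.
  have Eg : cl g = cl (As f) - cl (Bs f) by rewrite -(model_sub clP).
  have EAB : cl (op_sub A B g) = cl (A g) - cl (B g) by rewrite -(model_sub clP).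
  rewrite L2norm_sqr -!(model_rip clP) // EAB (ipBl (model_ip clP)).
  rewrite !(model_rip clP) // ripA ripB -!(model_rip clP) //.
  by rewrite -(ipBr (model_ip clP)) -Eg.
have [g0|g0] := eqVneq (nrm g) 0; first by rewrite g0 mulr_ge0 ?L2norm_ge0.
have gp : 0 < nrm g by rewrite lt_def g0 L2norm_ge0.
rewrite -(ler_pM2r gp) -expr2 sq -(model_rip clP) //.
apply: le_trans (ler_norm _) _; apply: le_trans (cauchy_schwarz (model_ip clP) _ _) _.
rewrite !(model_norm clP) // mulrAC ler_wpM2r ?L2norm_ge0 //.
exact: AB.
Qed.

Let half_sum_le (c : R[i]) f g (M : R) : normc c = 2^-1 -> L2 f -> L2 g ->
  nrm f <= M -> nrm g <= M -> nrm (fun t => c * (f t + g t)) <= M.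
Proof.
move=> c2 Lf Lg fM gM; rewrite L2norm_scale //; last exact: L2_add.
have := L2norm_triangle mD clP Lf Lg; rewrite c2; lra.
Qed.

Let half_diff_le (c : R[i]) f g (M : R) : normc c = 2^-1 -> L2 f -> L2 g ->
  nrm f <= M -> nrm g <= M -> nrm (fun t => c * (f t - g t)) <= M.
Proof.
move=> c2 Lf Lg fM gM; rewrite L2norm_scale //; last exact: L2_sub.
have := L2norm_triangleB mD clP Lf Lg; rewrite c2; lra.
Qed.

Let normc_half : normc ((2%:R)^-1 : R[i]) = 2^-1.
Proof. by rewrite Normc.normcV -(rmorph_nat (real_complex R)) normc_real ger0_norm. Qed.

Let normc_half_i : normc ((2%:R * 'i)^-1 : R[i]) = 2^-1.
Proof.
rewrite Normc.normcV Normc.normcM -(rmorph_nat (real_complex R))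
  normc_real ger0_norm //.
by rewrite /= expr0n expr1n add0r sqrtr1 mulr1.
Qed.

Section op_re_im.
Variables (A As : operator R T).
Hypotheses (bA : bounded A) (bAs : bounded As).

Lemma op_re_L2 f : L2 f -> L2 (op_re A As f).
Proof. by move=> Lf; apply: L2_scale => //; apply: L2_add => //; exact: bounded_L2. Qed.

Lemma op_im_L2 f : L2 f -> L2 (op_im A As f).
Proof. by move=> Lf; apply: L2_scale => //; apply: L2_sub => //; exact: bounded_L2. Qed.

Lemma op_re_le (M : R) : op_le A M -> op_le As M -> op_le (op_re A As) M.
Proof.
move=> AM AsM f Lf; apply: (half_sum_le normc_half); rewrite ?AM ?AsM //;
  exact: bounded_L2.
Qed.

Lemma op_im_le (M : R) : op_le A M -> op_le As M -> op_le (op_im A As) M.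
Proof.
move=> AM AsM f Lf; apply: (half_diff_le normc_half_i); rewrite ?AM ?AsM //;
  exact: bounded_L2.
Qed.

End op_re_im.

Lemma op_re_sub A As B Bs f :
  op_sub (op_re A As) (op_re B Bs) f = op_re (op_sub A B) (op_sub As Bs) f.
Proof.
by apply/funext => x; rewrite /op_re /op_sub -mulrBr opprD addrACA.
Qed.

Lemma op_im_sub A As B Bs f :
  op_sub (op_im A As) (op_im B Bs) f = op_im (op_sub A B) (op_sub As Bs) f.
Proof.
by apply/funext => x; rewrite /op_im /op_sub -mulrBr !opprD addrACA.
Qed.

Lemma op_le_add A B (M M' : R) : bounded A -> bounded B ->
  op_le A M -> op_le (op_sub B A) M' -> op_le B (M + M').
Proof.
move=> bA bB AM BA f Lf.
have LA := bounded_L2 bA Lf; have LB := bounded_L2 bB Lf.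
have := L2norm_triangle mD clP (L2_sub mD LB LA) LA.
rewrite (_ : (fun _ => _) = B f); last by apply/funext => x; rewrite subrK.
move/le_trans; apply; rewrite mulrDl addrC lerD //; [exact: AM | exact: BA].
Qed.

(** Norms of the perturbed operators exceed those of $B$ and $B^*$ by at most
    $\delta < 1$, so one constant serves all of them. *)
Lemma sharp_perturbation B S : bounded B -> is_sharp mu D B S ->
  exists2 C : R, 0 <= C & forall (del : R) B' S', 0 < del < 1 ->
    bounded B' -> is_sharp mu D B' S' -> op_le (op_sub B' B) del ->
    op_le (op_sub S' S) (C * ((1 + `|ln del|) * del)).
Proof.
move=> bB [bS [Bs [absRe [absIm [adjB reP imP SE]]]]].
have bBs : bounded Bs by case: adjB.
have [M1 M10 BM1] := bounded_norm bB; have [M2 M20 BM2] := bounded_norm bBs.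
pose M := M1 + M2 + 1.
have [BM BsM] : op_le B (M1 + M2) /\ op_le Bs (M1 + M2).
  split=> f Lf; first apply: le_trans (BM1 _ Lf) _; last apply: le_trans (BM2 _ Lf) _;
    rewrite ler_wpM2r ?L2norm_ge0 //; lra.
have M0 : 0 <= M by rewrite /M; lra.
exists (2 * (2 * M + 28)); first by lra.
move=> del B' S' d01 bB' [bS' [Bs' [absRe' [absIm' [adjB' reP' imP' SE']]]]] BB'.
have bBs' : bounded Bs' by case: adjB'.
case/andP: (d01) => d0 d1.
have BBs' := adjoint_sub_le (ltW d0) bB' bB adjB' adjB BB'.
have weak X (N N' : R) : N <= N' -> op_le X N -> op_le X N'.
  by move=> NN XN f Lf; apply: le_trans (XN f Lf) _; rewrite ler_wpM2r ?L2norm_ge0.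
have BM' : op_le B' M.
  apply: weak (op_le_add bB bB' BM BB'); rewrite /M; lra.
have BsM' : op_le Bs' M.
  apply: weak (op_le_add bBs bBs' BsM BBs'); rewrite /M; lra.
have {}BM : op_le B M by apply: weak BM; rewrite /M; lra.
have {}BsM : op_le Bs M by apply: weak BsM; rewrite /M; lra.
have bBB := bounded_sub mD clP bB' bB; have bBBs := bounded_sub mD clP bBs' bBs.
have Hre : op_le (op_sub absRe' absRe) ((2 * M + 28) * ((1 + `|ln del|) * del)).
  apply: (absop_perturbation mD clP M0 d01 _ _ reP' reP).
  - exact: op_re_L2.
  - exact: op_re_L2.
  - exact: op_re_le.
  - exact: op_re_le.
  - by move=> f Lf; rewrite op_re_sub; exact: op_re_le.
have Him : op_le (op_sub absIm' absIm) ((2 * M + 28) * ((1 + `|ln del|) * del)).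
  apply: (absop_perturbation mD clP M0 d01 _ _ imP' imP).
  - exact: op_im_L2.
  - exact: op_im_L2.
  - exact: op_im_le.
  - exact: op_im_le.
  - by move=> f Lf; rewrite op_im_sub; exact: op_im_le.
move=> f Lf.
have LR' : L2 (absRe' f) by case: reP' => b _; exact: bounded_L2.
have LI' : L2 (absIm' f) by case: imP' => b _; exact: bounded_L2.
have LR : L2 (absRe f) by case: reP => b _; exact: bounded_L2.
have LI : L2 (absIm f) by case: imP => b _; exact: bounded_L2.
have LS := bounded_L2 bS Lf; have LS' := bounded_L2 bS' Lf.
have cS : cl (S f) = cl (absRe f) + cl (absIm f).
  rewrite -(model_add clP) //; apply: (model_ae mD clP) => //;
    [exact: L2_add | exact: SE].
have cS' : cl (S' f) = cl (absRe' f) + cl (absIm' f).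
  rewrite -(model_add clP) //; apply: (model_ae mD clP) => //;
    [exact: L2_add | exact: SE'].
have := Hre f Lf; have := Him f Lf.
rewrite -!(model_norm clP); do ?[by apply: L2_sub]; rewrite /op_sub; do ?[by []].
rewrite !(model_sub clP) // cS cS' opprD addrACA => Hi Hr.
apply: le_trans (ipnormD (model_ip clP) _ _) _.
apply: le_trans (lerD Hr Hi) _.
by rewrite le_eqVlt; apply/orP; left; apply/eqP; ring.
Qed.

Lemma iter_L2 A j f : bounded A -> L2 f -> L2 (iter j A f).
Proof. by move=> bA Lf; elim: j => //= j IH; exact: bounded_L2. Qed.

Lemma L2norm_sum_le n (F : nat -> T -> R[i]) (c : nat -> R) :
  (forall j, L2 (F j)) -> (forall j, nrm (F j) <= c j) ->
  L2 (fun x => \sum_(j < n) F j x) /\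
  nrm (fun x => \sum_(j < n) F j x) <= \sum_(j < n) c j.
Proof.
move=> LF Fc; elim: n => [|n [LS IH]].
  rewrite (_ : (fun _ => _) = (fun=> 0)); last by apply/funext => x; rewrite big_ord0.
  split; first exact: L2_0.
  rewrite big_ord0 -[X in nrm X](_ : (fun x : T => 0 * 0) = _); last first.
    by apply/funext => x; rewrite mul0r.
  by rewrite (@L2norm_scale _ _ _ _ _ mD 0) ?Normc.normc0 ?mul0r //; exact: L2_0.
rewrite (_ : (fun _ => _) = (fun x => \sum_(j < n) F j x + F n x)); last first.
  by apply/funext => x; rewrite big_ord_recr.
split; first exact: L2_add.
rewrite big_ord_recr /=; apply: le_trans (L2norm_triangle mD clP LS (LF n)) _.
exact: lerD.
Qed.

Lemma iter_norm A j (M : R) : bounded A -> 0 <= M -> op_le A M ->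
  op_le (iter j A) (M ^+ j).
Proof.
move=> bA M0 AM f Lf; elim: j => [|j IH]; first by rewrite mul1r.
rewrite iterS exprS; apply: le_trans (AM _ (iter_L2 j bA Lf)) _.
by rewrite -mulrA ler_wpM2l.
Qed.

Lemma iter_perturbation A A' j (M rho : R) : bounded A -> bounded A' ->
  0 <= M -> op_le A M -> op_le A' M -> 0 <= rho -> op_le (op_sub A' A) rho ->
  op_le (op_sub (iter j A') (iter j A)) (j%:R * M ^+ j.-1 * rho).
Proof.
move=> bA bA' M0 AM AM' rho0 AA'.
elim: j => [|j IH] f Lf.
  rewrite !mul0r /op_sub /= (_ : (fun _ => _) = (fun x => 0 * f x)).
    by rewrite L2norm_scale // Normc.normc0 mul0r.
  by apply/funext => x; rewrite subrr mul0r.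
have Li := iter_L2 j bA Lf; have Li' := iter_L2 j bA' Lf.
have LAi := bounded_L2 bA Li; have LAi' := bounded_L2 bA Li'.
have LA'i' := bounded_L2 bA' Li'.
have H1 := AA' _ Li'; have H2 := iter_norm j bA' M0 AM' Lf.
have H3 := IH f Lf.
have dL : L2 (fun x => iter j A' f x - iter j A f x) by exact: L2_sub.
have LAd := bounded_L2 bA dL; have H4 := AM _ dL.
have E : cl (A (iter j A' f)) - cl (A (iter j A f)) =
    cl (A (fun x => iter j A' f x - iter j A f x)).
  by rewrite -!(lift_lin_cl mD clP bA) // -raddfB (model_sub clP).
rewrite /op_sub !iterS -(model_norm clP); last exact: L2_sub.
rewrite (model_sub clP) //.
apply: le_trans (ipnorm_dist_triangle (model_ip clP) (cl (A (iter j A' f))) _ _) _.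
rewrite E -(model_sub clP) // !(model_norm clP) //; last exact: L2_sub.
apply: le_trans (lerD H1 H4) _.
apply: le_trans (lerD (ler_wpM2l rho0 H2) (ler_wpM2l M0 H3)) _.
rewrite le_eqVlt; apply/orP; left; apply/eqP => /=.
case: j {IH Li Li' LAi LAi' LA'i' H1 H2 H3 dL LAd H4 E} => [|j] /=; first by ring.
by rewrite -[j.+2%:R]natr1 exprS; ring.
Qed.

Lemma op_poly_L2 (P : {poly R[i]}) A f : bounded A -> L2 f -> L2 (op_poly P A f).
Proof.
move=> bA Lf.
have [] // := @L2norm_sum_le (size P) (fun j x => P`_j * iter j A f x)
  (fun j => nrm (fun x => P`_j * iter j A f x)).
by move=> j; apply: L2_scale => //; exact: iter_L2.
Qed.

Lemma op_poly_norm (P : {poly R[i]}) A (M : R) : bounded A -> 0 <= M -> op_le A M ->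
  op_le (op_poly P A) (\sum_(j < size P) normc P`_j * M ^+ j).
Proof.
move=> bA M0 AM f Lf; rewrite mulr_suml.
have [|j|_] := @L2norm_sum_le (size P) (fun j x => P`_j * iter j A f x)
  (fun j => normc P`_j * M ^+ j * nrm f).
- by move=> j; apply: L2_scale => //; exact: iter_L2.
- rewrite L2norm_scale //; last exact: iter_L2.
  by rewrite -mulrA ler_wpM2l ?normc_ge0 // iter_norm.
by [].
Qed.

Lemma op_poly_perturbation (P : {poly R[i]}) A A' (M rho : R) :
  bounded A -> bounded A' -> 0 <= M -> op_le A M -> op_le A' M ->
  0 <= rho -> op_le (op_sub A' A) rho ->
  op_le (op_sub (op_poly P A') (op_poly P A))
    ((\sum_(j < size P) normc P`_j * (j%:R * M ^+ j.-1)) * rho).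
Proof.
move=> bA bA' M0 AM AM' rho0 AA' f Lf; rewrite !mulr_suml.
have [|j|_] := @L2norm_sum_le (size P)
  (fun j x => P`_j * (iter j A' f x - iter j A f x))
  (fun j => normc P`_j * (j%:R * M ^+ j.-1) * rho * nrm f).
- by move=> j; apply: L2_scale => //; apply: L2_sub => //; exact: iter_L2.
- rewrite L2norm_scale //; last by apply: L2_sub => //; exact: iter_L2.
  by rewrite -!mulrA ler_wpM2l ?normc_ge0 // !mulrA; exact: iter_perturbation.
rewrite (_ : (fun _ => _) = op_sub (op_poly P A') (op_poly P A) f) //.
by apply/funext => x; rewrite /op_sub /op_poly -sumrB; apply: eq_bigr => j _;
  rewrite mulrBr.
Qed.

(** Since $|\ln\delta|\,\delta \le 1$ on $(0,1)$, the operators $B'_\#$ are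
    bounded uniformly, and on bounded sets both the polynomial $P$ and the
    square of the norm are Lipschitz. *)
Lemma sharp_poly_perturbation (P : {poly R[i]}) B S (K : R) :
  bounded B -> is_sharp mu D B S ->
  exists2 C : R, 0 < C & forall (del : R) B' S' phi, 0 < del < 1 ->
    bounded B' -> is_sharp mu D B' S' -> op_le (op_sub B' B) del ->
    L2 phi -> nrm phi <= K ->
    `|nrm (op_poly P S' phi) ^+ 2 - nrm (op_poly P S phi) ^+ 2| <=
      C * (1 + `|ln del|) * del.
Proof.
move=> bB BS; have bS : bounded S by case: BS.
have [C1 C10 HC1] := sharp_perturbation bB BS.
have [M1 M10 SM1] := bounded_norm bS.
(* The increment 2 C1 absorbs the perturbation C1 (1 + |ln del|) del of S. *)
pose M := M1 + 2 * C1.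
have M0 : 0 <= M by rewrite /M; lra.
pose c1 : R := \sum_(j < size P) normc P`_j * (j%:R * M ^+ j.-1).
pose c0 : R := \sum_(j < size P) normc P`_j * M ^+ j.
have c10 : 0 <= c1 by apply: sumr_ge0 => j _; rewrite !mulr_ge0 ?normc_ge0 ?exprn_ge0.
have c00 : 0 <= c0 by apply: sumr_ge0 => j _; rewrite !mulr_ge0 ?normc_ge0 ?exprn_ge0.
pose k : R := `|K|.
have Ck : 0 <= (c1 * C1 * k) * (2 * (c0 * k)) by rewrite !mulr_ge0 // normr_ge0.
exists ((c1 * C1 * k) * (2 * (c0 * k)) + 1); first by lra.
move=> del B' S' phi d01 bB' BS' BB' Lphi phiK.
have bS' : bounded S' by case: BS'.
have SS' := HC1 del B' S' d01 bB' BS' BB'.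
case/andP: d01 => d0 d1.
set L := (1 + `|ln del|) * del in SS'.
have L0 : 0 <= L by rewrite mulr_ge0 ?(ltW d0) // addr_ge0.
have L2 : L <= 2.
  have : `|ln del| * del <= 1.
    rewrite -ler_pdivlMr // mul1r ler0_norm ?ln_le0 ?(ltW d1) // -lnV //.
    have := @le_ln1Dx R (del^-1 - 1); rewrite addrCA subrr addr0.
    have : 0 < del^-1 by rewrite invr_gt0.
    by move=> ? H; apply: le_trans (H _) _; lra.
  rewrite /L mulrDl mul1r; lra.
have SM : op_le S M.
  move=> f Lf; apply: le_trans (SM1 f Lf) _.
  by rewrite ler_wpM2r ?L2norm_ge0 // /M; lra.
have SM' : op_le S' M.
  move=> f Lf; apply: le_trans (op_le_add bS bS' SM1 SS' Lf) _.
  rewrite ler_wpM2r ?L2norm_ge0 // /M lerD2l mulrC ler_wpM2r //.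
have phik : nrm phi <= k by apply: le_trans phiK (ler_norm _).
have H1 := op_poly_perturbation P bS bS' M0 SM SM' (mulr_ge0 C10 L0) SS' Lphi.
have H2 := op_poly_norm P bS M0 SM Lphi; have H3 := op_poly_norm P bS' M0 SM' Lphi.
rewrite -/c0 -/c1 in H1 H2 H3.
have LP := op_poly_L2 P bS Lphi; have LP' := op_poly_L2 P bS' Lphi.
apply: le_trans (L2norm_sqr_dist mD clP LP' LP) _.
have c0k : c0 * nrm phi <= c0 * k by rewrite ler_wpM2l.
apply: le_trans (_ : (c1 * (C1 * L) * k) * (2 * (c0 * k)) <= _).
  apply: ler_pM; rewrite ?L2norm_ge0 ?addr_ge0 ?L2norm_ge0 //.
    by apply: le_trans H1 _; rewrite ler_wpM2l // (mulr_ge0 c10) // mulr_ge0.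
  lra.
rewrite -[_ * (1 + _) * del]mulrA -/L [leRHS]mulrDl mul1r.
apply: le_trans (_ : c1 * C1 * k * (2 * (c0 * k)) * L <= _); last by rewrite lerDl.
by rewrite le_eqVlt; apply/orP; left; apply/eqP; ring.
Qed.

End sharp_perturbation.

(** * Hausdorff measure: measurability of Lipschitz functions *)

Section cover_measure_theory.
Local Open Scope ereal_scope.
Context {R : realType} {T : pointedType}.
Implicit Types (w : set T -> \bar R) (A X Y : set T).

Lemma cover_measure_le_weight w A : cover_measure w A <= weight0 w A.
Proof.
apply: ereal_inf_lbound; exists (fun k => if k is 0%N then A else set0).
  by split => // x Ax; exists 0%N.
rewrite nneseries_recl //; last by move=> k _; exact: weight0_ge0.
rewrite [X in _ + X]eseries0 ?adde0 // => -[|k] // _ _.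
exact: weight00.
Qed.

Lemma weight0_le w w' : (forall A, w A <= w' A) ->
  forall A, weight0 w A <= weight0 w' A.
Proof.
move=> ww' A; rewrite /weight0; case: asboolP => // _.
by rewrite ge_max !le_max lexx /= ww' orbT.
Qed.

Lemma cover_measure_le w w' : (forall A, w A <= w' A) ->
  forall X, cover_measure w X <= cover_measure w' X.
Proof.
move=> ww' X; apply: le_ereal_inf_tmp => _ [A XA <-].
apply: le_trans (_ : \sum_(0 <= k <oo) weight0 w (A k) <= _).
  by apply: ereal_inf_lbound; exists A.
apply: lee_nneseries => [k _ _|k _]; first exact: weight0_ge0.
exact: weight0_le.
Qed.

(** A set of finite weight meets at most one of $X$ and $Y$, so a cover of the
    union splits into a cover of $X$ and a cover of $Y$. *)
Lemma cover_measure_separated w X Y :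
  (forall C, w C < +oo -> C `&` X = set0 \/ C `&` Y = set0) ->
  cover_measure w X + cover_measure w Y <= cover_measure w (X `|` Y).
Proof.
move=> sep; apply: le_ereal_inf_tmp => _ [A [_ XYA] <-].
pose B Z k := if `[< A k `&` Z = set0 >] then set0 else A k.
have BE Z : Z `<=` X `|` Y -> cover_measure w Z <= \sum_(0 <= k <oo) weight0 w (B Z k).
  move=> ZXY; apply: ereal_inf_lbound; exists (B Z) => //; split => // x Zx.
  have [k _ Akx] := XYA x (ZXY x Zx); exists k => //.
  rewrite /B; case: asboolP => // AZ0.
  by have : (A k `&` Z) x by []; rewrite AZ0.
have BX := BE X (@subsetUl _ X Y); have BY := BE Y (@subsetUr _ X Y).
apply: le_trans (leeD BX BY) _.
have B0 Z k : 0 <= weight0 w (B Z k) by exact: weight0_ge0.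
rewrite -nneseriesD //; apply: lee_nneseries => [k _ _|k _]; first exact: adde_ge0.
have Bsub Z : weight0 w (B Z k) <= weight0 w (A k).
  by rewrite /B; case: asboolP => // _; rewrite weight00 weight0_ge0.
have [AX|AX] := pselect (A k `&` X = set0).
  by rewrite {1}/B; case: asboolP => // _; rewrite weight00 add0e.
have [AY|AY] := pselect (A k `&` Y = set0).
  by rewrite {2}/B [X in _ + weight0 w X](_ : _ = set0) ?weight00 ?adde0 //;
    case: asboolP.
suff -> : weight0 w (A k) = +oo by rewrite leey.
rewrite /weight0; case: asboolP => [Ak0|_]; first by case: AX; rewrite Ak0 set0I.
have [wA|] := ltP (w (A k)) +oo; first by case: (sep _ wA).
by rewrite leye_eq => /eqP ->; rewrite maxey.
Qed.

End cover_measure_theory.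

Lemma ereal_sup_add_le (R : realType) (S1 S2 : set (\bar R)) (h : \bar R) :
  S1 !=set0 -> S2 !=set0 ->
  (forall x, S1 x -> 0 <= x)%E -> (forall y, S2 y -> 0 <= y)%E ->
  (forall x y, S1 x -> S2 y -> x + y <= h)%E -> (ereal_sup S1 + ereal_sup S2 <= h)%E.
Proof.
move=> [x0 S1x0] [y0 S2y0] S1p S2p S12.
have [->|hy] := eqVneq h +oo%E; first by rewrite leey.
have hfin : (h < +oo)%E by rewrite ltey.
have fin z : (0 <= z -> z <= h -> z \is a fin_num)%E.
  by move=> z0 zh; rewrite ge0_fin_numE // (le_lt_trans zh).
have S1fin x : S1 x -> x \is a fin_num.
  move=> S1x; apply: fin; first exact: S1p.
  by apply: le_trans (S12 _ _ S1x S2y0); rewrite leeDl // S2p.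
have S2fin y : S2 y -> y \is a fin_num.
  move=> S2y; apply: fin; first exact: S2p.
  by apply: le_trans (S12 _ _ S1x0 S2y); rewrite leeDr // S1p.
have sup1 y : S2 y -> (ereal_sup S1 + y <= h)%E.
  move=> S2y; rewrite -leeBrDr ?S2fin //; apply: ge_ereal_sup => x S1x.
  by rewrite leeBrDr ?S2fin // S12.
have s10 : (0 <= ereal_sup S1)%E.
  by apply: le_trans (S1p _ S1x0) _; exact: ereal_sup_ubound.
have s1fin : ereal_sup S1 \is a fin_num.
  by apply: fin => //; apply: le_trans (sup1 _ S2y0); rewrite leeDl // S2p.
rewrite -leeBrDl //; apply: ge_ereal_sup => y S2y.
by rewrite leeBrDl // sup1.
Qed.

Lemma sume_even_odd (R : numDomainType) (f : nat -> \bar R) m :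
  (\sum_(k < 2 * m) f k =
   \sum_(k < m) f (2 * k + 0)%N + \sum_(k < m) f (2 * k + 1)%N)%E.
Proof.
elim: m => [|m IH]; first by rewrite muln0 !big_ord0 adde0.
rewrite mulnS !big_ord_recr /= IH addn0 addn1 !addeA; congr (_ + _)%E.
by rewrite addeAC.
Qed.

Section euclidean_norm.
Context {R : realType} {d : nat}.
Implicit Types (x y z : 'rV[R]_d).

Lemma dot_semi_inner_product : semi_inner_product (@dot R d).
Proof.
split=> [x y|a x y z|x].
- by apply: eq_bigr => i _; rewrite mulrC.
- rewrite /dot mulr_sumr -big_split; apply: eq_bigr => i _ /=.
  by rewrite !mxE mulrDl mulrA.
by apply: sumr_ge0 => i _; rewrite -expr2 sqr_ge0.
Qed.

Lemma enorm_ge0 x : 0 <= enorm x. Proof. exact: sqrtr_ge0. Qed.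

Lemma enorm_lipschitz x y : `|enorm x - enorm y| <= enorm (x - y).
Proof.
have H := ipnormD dot_semi_inner_product (x - y) y; rewrite subrK in H.
have H' := ipnormD dot_semi_inner_product (y - x) x.
rewrite subrK (ipnormBC dot_semi_inner_product) in H'.
rewrite ler_norml; apply/andP.
by split; rewrite /enorm; move: H H'; rewrite /ipnorm; lra.
Qed.

Lemma dot_lipschitz z x y : `|dot z x - dot z y| <= enorm z * enorm (x - y).
Proof.
rewrite -(ipBr dot_semi_inner_product).
exact: (cauchy_schwarz dot_semi_inner_product).
Qed.

Lemma enorm_le_sum x : enorm x <= \sum_i `|x 0 i|.
Proof.
have E : x = \sum_i x 0 i *: delta_mx 0 i.
  by rewrite {1}[x]row_sum_delta.
rewrite {1}E; apply: le_trans (ipnorm_sum dot_semi_inner_product _) _.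
apply: ler_sum => i _; rewrite (ipnormZ dot_semi_inner_product) ler_piMr //.
rewrite /ipnorm /dot (bigD1 i) //= big1 ?addr0.
  by rewrite mxE !eqxx mulr1 sqrtr1.
by move=> j ji; rewrite mxE (negPf ji) mulr0.
Qed.

Lemma enorm_sqr x : enorm x ^+ 2 = \sum_i x 0 i ^+ 2.
Proof. exact: (ipnorm_sqr dot_semi_inner_product). Qed.

End euclidean_norm.

Section hausdorff_metric.
Context {R : realType} {d : nat} (s : nat).
Local Notation E := 'rV[R]_d.
Local Notation H := (hausdorff_outer s : set E -> \bar R).
Implicit Types (X Y : set E).

Lemma ediam_ub (C : set E) x y : C x -> C y -> ((enorm (x - y))%:E <= ediam C)%E.
Proof. by move=> Cx Cy; apply: ereal_sup_ubound; exists (x, y). Qed.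

Lemma diam_weight_le (e e' : R) (A : set E) : e <= e' ->
  (diam_weight s e' A <= diam_weight s e A)%E.
Proof.
move=> ee'; rewrite /diam_weight.
have [eA|_] := boolP (ediam A <= e%:E)%E; last by rewrite leey.
by rewrite (le_trans eA) // lee_fin.
Qed.

(** A set of diameter below $\rho$ meets at most one of $X$ and $Y$. *)
Lemma hausdorff_separated X Y (rho : R) : 0 < rho ->
  (forall x y, X x -> Y y -> rho <= enorm (x - y)) -> (H X + H Y <= H (X `|` Y))%E.
Proof.
move=> rho0 sep.
apply: ereal_sup_add_le.
- by exists (cover_measure (diam_weight s 1) X); exists 1 => //=.
- by exists (cover_measure (diam_weight s 1) Y); exists 1 => //=.
- by move=> _ [e e0 <-]; exact: outer_measure_ge0.
- by move=> _ [e e0 <-]; exact: outer_measure_ge0.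
move=> _ _ [e1 /= e10 <-] [e2 /= e20 <-].
pose e := Num.min (Num.min e1 e2) (rho / 2).
have e0 : 0 < e by rewrite !lt_min e10 e20 divr_gt0.
have ee1 : e <= e1 by rewrite !ge_min lexx.
have ee2 : e <= e2 by rewrite !ge_min lexx orbT.
have erho : e < rho.
  by apply: le_lt_trans (_ : rho / 2 < rho); rewrite ?ge_min ?lexx ?orbT //; lra.
apply: le_trans (_ : cover_measure (diam_weight s e) (X `|` Y) <= _)%E; last first.
  by apply: ereal_sup_ubound; exists e.
apply: le_trans (cover_measure_separated _).
  by apply: leeD; apply: cover_measure_le => A; exact: diam_weight_le.
move=> C wC; have {wC} Ce : (ediam C <= e%:E)%E.
  by move: wC; rewrite /diam_weight; case: ifP.
have [CX|/eqP/set0P[x [Cx Xx]]] := pselect (C `&` X = set0); first by left.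
right; apply/seteqP; split => // y [Cy Yy].
have := le_trans (ediam_ub Cx Cy) Ce; rewrite lee_fin leNgt.
by rewrite (lt_le_trans erho (sep _ _ Xx Yy)).
Qed.

(** Carathéodory's criterion. The sets $\{g \ge 1/(n+2)\}$ lie at positive
    distance from $\{g \le 0\}$ and exhaust $\{g > 0\}$. Among the layers between
    consecutive ones, those of even index lie at positive distance from each
    other, and so do those of odd index; hence the measures of all layers have a
    finite sum, and the measure of the layers after the $n$-th tends to zero. *)
Lemma lipschitz_superlevel_measurable (g : E -> R) (L : R) : 0 < L ->
  (forall x y, `|g x - g y| <= L * enorm (x - y)) ->
  caratheodory_measurable H [set x | 0 < g x].
Proof.
move=> L0 gL; apply: le_caratheodory_measurable => X.
set A := [set x | 0 < g x].
have [HX|HX] := eqVneq (H X) +oo%E; first by rewrite /= HX leey.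
have {}HX : (H X < +oo)%E by rewrite ltey.
pose a (n : nat) : R := n.+1%:R^-1.
have a0 n : 0 < a n by rewrite invr_gt0.
have aD m n : (m < n)%N -> a n < a m.
  by move=> mn; rewrite ltf_pV2 ?posrE // ltr_nat.
have aW m n : (m <= n)%N -> a n <= a m.
  by move=> mn; rewrite lef_pV2 ?posrE // ler_nat.
have sep Y Z (u v : R) : v < u ->
    Y `<=` [set x | u <= g x] -> Z `<=` [set x | g x <= v] ->
    (H Y + H Z <= H (Y `|` Z))%E.
  move=> uv Yu Zv; apply: (@hausdorff_separated _ _ ((u - v) / L)).
    by rewrite divr_gt0 // subr_gt0.
  move=> x y Yx Zy; rewrite ler_pdivrMr // mulrC.
  apply: le_trans (gL x y); apply: le_trans (ler_norm _).
  by apply: lerB; [exact: Yu | exact: Zv].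
pose Y n := X `&` [set x | a n.+1 <= g x].
pose Q n := X `&` [set x | a n.+2 <= g x < a n.+1].
have HY n : (H (Y n) + H (X `&` ~` A) <= H X)%E.
  apply: le_trans (sep _ _ _ _ (a0 n.+1) _ _) _.
  - by move=> x [].
  - by move=> x [_ /negP]; rewrite -leNgt.
  by apply: le_outer_measure => x [] [].
(* b = 0 and b = 1 give the layers of even and of odd index. *)
have HQ b m : (\sum_(k < m) H (Q (2 * k + b)%N) <=
    H (X `&` [set x | (a (2 * m + b)%N <= g x)%R]))%E.
  elim: m => [|m IH]; first by rewrite big_ord0 outer_measure_ge0.
  rewrite big_ord_recr /=; apply: le_trans (leeD IH (lexx _)) _.
  apply: le_trans (sep _ _ _ _ (aD _ _ (ltnSn (2 * m + b)%N)) _ _) _.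
  - by move=> x [].
  - by move=> x [_ /andP[_ /ltW]].
  have -> : (2 * m.+1 + b = (2 * m + b).+2)%N by rewrite mulnS.
  apply: le_outer_measure => x [] [Xx] /= gx; split => //=.
    by apply: le_trans gx; apply: aW; rewrite leqW.
  by case/andP: gx.
have HQ2 m : (\sum_(k < 2 * m) H (Q k) <= H X + H X)%E.
  rewrite (sume_even_odd (fun k => H (Q k))).
  by apply: leeD; apply: le_trans (HQ _ _) _; apply: le_outer_measure => x [].
have H0 Z : (0 <= H Z)%E by exact: outer_measure_ge0.
have sumQ : (\sum_(0 <= k <oo) H (Q k) < +oo)%E.
  apply: le_lt_trans (_ : H X + H X < +oo)%E; last by rewrite lte_add_pinfty.
  apply: lime_le; first exact: is_cvg_nneseries.
  near=> n; apply: le_trans (HQ2 n); rewrite big_mkord.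
  rewrite mul2n -addnn big_split_ord /= leeDl //.
  by apply: sume_ge0.
have tail := nneseries_tail_cvg sumQ (fun k _ => H0 (Q k)).
have XA n : X `&` A `<=` Y n `|` \bigcup_(k in ~` `I_n) Q k.
  move=> x [Xx Ax]; have [nx|nx] := leP (a n.+1) (g x); first by left.
  right; have ex : exists m, a m.+2 <= g x.
    have gx0 : 0 < (g x)^-1 by rewrite invr_gt0.
    have bnd := archi_boundP (ltW gx0).
    exists (Num.bound (g x)^-1); rewrite invf_ple ?posrE // (le_trans (ltW bnd)) //.
    by rewrite ler_nat -addn3 leq_addr.
  case: (ex_minnP ex) => k kx kmin; exists k.
    move=> /= kn; move: nx; rewrite ltNge (le_trans _ kx) //; apply: aW.
    by rewrite !ltnS.
  split => //=; rewrite kx /=; case: k kx kmin => [|k] kx kmin.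
    by apply: lt_le_trans nx _; apply: aW.
  by rewrite ltNge; apply/negP => /kmin; rewrite ltnn.
apply/lee_addgt0Pr => e e0.
have [n _ /(_ n (leqnn n)) tn] : \forall n \near \oo,
    (\sum_(n <= k <oo) H (Q k) < e%:E)%E.
  by apply: (tail [set y | (y < e%:E)%E]); apply: open_ereal_lt'; rewrite lte_fin.
have XAn := le_trans (le_outer_measure (hausdorff_outer s) _ _ (XA n))
  (outer_measureU2 _ _ _).
apply: le_trans (leeD2r _ XAn) _.
rewrite addeAC; apply: leeD; first exact: HY.
apply: le_trans (outer_measure_sigma_subadditive_tail _ _ _) _; exact: ltW.
Unshelve. all: by end_near. Qed.

Lemma lipschitz_measurable (g : E -> R) (L : R) : 0 < L ->
  (forall x y, `|g x - g y| <= L * enorm (x - y)) ->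
  measurable_fun [set: caratheodory_type H] g.
Proof.
move=> L0 gL mT; apply: (measurability _ (RGenOInfty.measurableE R)) => //.
move=> _ [_ [c ->] <-]; rewrite setTI.
have := @lipschitz_superlevel_measurable (fun x => g x - c) L L0.
have -> : [set x | 0 < g x - c] = g @^-1` `]c, +oo[.
  by apply/seteqP; split => x /=; rewrite in_itv /= andbT subr_gt0.
by apply => x y; rewrite opprB addrA subrK.
Qed.

End hausdorff_metric.

(** * The unit sphere has finite surface measure *)

Lemma ord_interval_cover (R : realType) (n : nat) (t : R) :
  (0 < n)%N -> 0 <= t <= n%:R ->
  exists c : 'I_n, c%:R <= t <= c.+1%:R.
Proof.
case: n => // n _; elim: n => [|n IH] /andP[t0 tn].
  by exists ord0; rewrite t0.
have [tn1|tn1] := leP t n.+1%:R.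
  have [|c /andP[c1 c2]] := IH; first by rewrite t0.
  by exists (widen_ord (leqnSn _) c); rewrite /= c1.
by exists ord_max; rewrite /= (ltW tn1).
Qed.

Section unit_sphere.
Context {R : realType} (s : nat).
Local Notation E := 'rV[R]_s.+1.
Variable m : nat.

(** For $p = (i,b,c)$, the part of the sphere where the coordinate $i$ has the
    sign of $b$ and is at least $1/\sqrt{s+1}$ in absolute value, and where the
    other coordinates lie in a cell of side $1/m$. Over the other coordinates it
    is a Lipschitz graph. *)
Let cell (p : 'I_s.+1 * bool * {ffun 'I_s -> 'I_(2 * m)}) : set E :=
  [set x | [/\ enorm x = 1, (Num.sqrt s.+1%:R)^-1 <= (-1) ^+ p.1.2 * x 0 p.1.1 &
    forall j, (p.2 j)%:R <= m%:R * (x 0 (lift p.1.1 j) + 1) <= (p.2 j).+1%:R]].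

Hypothesis m0 : (0 < m)%N.

Let Rm0 : 0 < m%:R :> R. Proof. by rewrite ltr0n. Qed.

Let s0 : 0 < Num.sqrt s.+1%:R :> R. Proof. by rewrite sqrtr_gt0. Qed.

Lemma sphere_coord_le1 (x : E) i : enorm x = 1 -> `|x 0 i| <= 1.
Proof.
move=> x1; rewrite -(@ler_pXn2r _ 2) ?nnegrE // expr1n.
have := enorm_sqr x; rewrite x1 expr1n real_normK ?num_real // => ->.
by rewrite (bigD1 i) //= lerDl sumr_ge0 // => j _; rewrite sqr_ge0.
Qed.

Let sphere_cells : sphere `<=` \bigcup_p cell p.
Proof.
move=> x x1.
have [i xi] : exists i, s.+1%:R^-1 <= x 0 i ^+ 2.
  apply/not_existsP => H'; have := enorm_sqr x.
  rewrite (x1 : enorm x = 1) expr1n => E1; suff : (1 : R) < 1 by rewrite ltxx.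
  rewrite {1}E1.
  have -> : (1 : R) = \sum_(i < s.+1) s.+1%:R^-1.
    by rewrite sumr_const card_ord -[RHS]mulr_natl divff.
  apply: ltr_sum => [|i _]; first by apply/hasP; exists ord0; rewrite ?mem_index_enum.
  by rewrite ltNge; apply/negP => /H'.
have cellj j : exists c : 'I_(2 * m), c%:R <= m%:R * (x 0 (lift i j) + 1) <= c.+1%:R.
  apply: ord_interval_cover; first by rewrite muln_gt0.
  have := sphere_coord_le1 (lift i j) x1; rewrite ler_norml => /andP[l u].
  rewrite mulr_ge0 ?ler0n //=; last by lra.
  by rewrite natrM mulrC ler_wpM2r ?ler0n //; lra.
exists ((i, x 0 i < 0), [ffun j => xchoose (cellj j)]) => //; split => //=.
  have : (Num.sqrt s.+1%:R)^-1 <= `|x 0 i|.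
    rewrite -(@ler_pXn2r _ 2) ?nnegrE ?invr_ge0 ?(ltW s0) //.
    by rewrite exprVn sqr_sqrtr ?ler0n // real_normK ?num_real.
  by rewrite normrEsign.
by move=> j; rewrite ffunE; exact: (xchooseP (cellj j)).
Qed.

Let C : R := s%:R * Num.sqrt s.+1%:R + s%:R.

(** On one sign of $x_i$, the product $(x_i-y_i)(x_i+y_i) =
    \sum_{j\ne i} (y_j^2-x_j^2)$ bounds $|x_i-y_i|$ by the other differences. *)
Let cell_diam p x y : cell p x -> cell p y -> enorm (x - y) <= C / m%:R.
Proof.
case: p => [[i b] c] [/= x1 xi xc] [/= y1 yi yc].
have other j : `|x 0 (lift i j) - y 0 (lift i j)| <= m%:R^-1.
  have /andP[u1 u2] := xc j; have /andP[v1 v2] := yc j.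
  rewrite -[m%:R^-1]mul1r ler_pdivlMr // -[X in _ * X](ger0_norm (ler0n _ m)) -normrM.
  move: u1 u2 v1 v2; rewrite -!natr1 => u1 u2 v1 v2.
  by rewrite ler_norml mulrC; apply/andP; split; lra.
have main : `|x 0 i - y 0 i| <= s%:R * Num.sqrt s.+1%:R / m%:R.
  have E1 : (x 0 i - y 0 i) * (x 0 i + y 0 i) =
      \sum_j (y 0 (lift i j) - x 0 (lift i j)) * (y 0 (lift i j) + x 0 (lift i j)).
    have sx := enorm_sqr x; have sy := enorm_sqr y.
    rewrite x1 (bigD1_ord i) //= in sx; rewrite y1 (bigD1_ord i) //= in sy.
    under eq_bigr => j _ do rewrite -subr_sqr.
    by rewrite sumrB -subr_sqr; move: sx sy; rewrite !expr1n; lra.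
  have plus : 2 * (Num.sqrt s.+1%:R)^-1 <= `|x 0 i + y 0 i|.
    apply: le_trans (_ : (-1) ^+ b * (x 0 i + y 0 i) <= _).
      by rewrite mulrDr; lra.
    by apply: le_trans (ler_norm _) _; rewrite normrM normr_sign mul1r.
  have rhs : `|x 0 i - y 0 i| * `|x 0 i + y 0 i| <= s%:R * (2 / m%:R).
    rewrite -normrM E1; apply: le_trans (ler_norm_sum _ _ _) _.
    rewrite mulr_natl -[X in _ *+ X](card_ord s) -sumr_const; apply: ler_sum => j _.
    rewrite normrM mulrC; apply: ler_pM => //; last by rewrite distrC.
    apply: le_trans (ler_normD _ _) _.
    by have := sphere_coord_le1 (lift i j) x1;
      have := sphere_coord_le1 (lift i j) y1; lra.
  have {rhs} := le_trans (ler_wpM2l (normr_ge0 _) plus) rhs.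
  rewrite mulrCA [leRHS]mulrCA ler_pM2l // ler_pdivrMr // => /le_trans; apply.
  by rewrite mulrAC.
apply: le_trans (enorm_le_sum _) _; rewrite (bigD1_ord i) //= /C mulrDl.
apply: lerD; first by rewrite !mxE.
rewrite mulr_natl -[X in _ *+ X](card_ord s) -sumr_const; apply: ler_sum => j _.
by rewrite !mxE.
Qed.

Let weight_cell p (e : R) : C / m%:R <= e ->
  (weight0 (diam_weight s e) (cell p) <=
    (@unit_ball_volume R s / 2 ^+ s * (C / m%:R) ^+ s)%:E)%E.
Proof.
move=> Ce; have v0 : 0 <= @unit_ball_volume R s.
  suff : 0 <= @unit_ball_volume R s /\ 0 <= @unit_ball_volume R s.+1 by case.
  elim: s => [|k [IH1 IH2]]; first by split.
  split => //=; rewrite mulr_ge0 // divr_ge0 // mulr_ge0 //; exact: pi_ge0.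
have C0 : 0 <= C / m%:R by rewrite divr_ge0 // /C addr_ge0 ?mulr_ge0 // ltW.
have vs0 : 0 <= @unit_ball_volume R s / 2 ^+ s by rewrite divr_ge0 // exprn_ge0.
rewrite /weight0; case: asboolP => [_|/eqP/set0P[x cx]].
  by rewrite lee_fin mulr_ge0 ?exprn_ge0.
have dC : (ediam (cell p) <= (C / m%:R)%:E)%E.
  by apply: ge_ereal_sup => _ [[y z] [/= cy cz] <-]; rewrite lee_fin;
    exact: cell_diam cy cz.
have d0 : (0 <= ediam (cell p))%E.
  by apply: le_trans (ediam_ub cx cx); rewrite lee_fin enorm_ge0.
rewrite ge_max lee_fin mulr_ge0 ?exprn_ge0 //= /diam_weight.
rewrite (le_trans dC) ?lee_fin //.
have fin : ediam (cell p) \is a fin_num.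
  by rewrite ge0_fin_numE // (le_lt_trans dC) // ltry.
rewrite -(fineK fin) in dC d0 *; rewrite !lee_fin in dC d0.
by rewrite -EFin_expe -EFinM lee_fin ler_wpM2l // lerXn2r // nnegrE.
Qed.

(** The number of cells is of order $m^s$ and the weight of each of order
    $m^{-s}$. *)
Lemma cover_measure_sphere_le (e : R) : C / m%:R <= e ->
  (cover_measure (diam_weight s e) (@sphere R s.+1) <=
    ((2 * s.+1)%:R * 2 ^+ s * (@unit_ball_volume R s / 2 ^+ s) * C ^+ s)%:E)%E.
Proof.
move=> Ce; pose I : finType := ('I_s.+1 * bool * {ffun 'I_s -> 'I_(2 * m)})%type.
pose F (k : nat) : set E :=
  if insub k is Some j then cell (enum_val (j : 'I_#|I|)) else set0.
apply: le_trans (_ : cover_measure (diam_weight s e)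
    (\big[setU/set0]_(k < #|I|) F k) <= _)%E.
  apply: le_outer_measure => x /sphere_cells[p _ px].
  rewrite -bigcup_mkord; exists (enum_rank p); first by rewrite /= ltn_ord.
  by rewrite /F valK enum_rankK.
apply: le_trans (outer_measure_subadditive _ _ _) _.
apply: le_trans (_ : \sum_(k < #|I|)
    (@unit_ball_volume R s / 2 ^+ s * (C / m%:R) ^+ s)%:E <= _)%E.
  apply: lee_sum => k _; apply: le_trans (cover_measure_le_weight _ _) _.
  by rewrite /F valK; exact: weight_cell.
rewrite sumEFin lee_fin sumr_const card_ord /I !card_prod card_ord card_bool.
rewrite card_ffun !card_ord -[_ *+ (_ * _)]mulr_natl expr_div_n.
have mn0 : m%:R ^+ s != 0 :> R by rewrite expf_neq0 // gt_eqF.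
rewrite le_eqVlt; apply/orP; left; apply/eqP.
rewrite !natrM natrX natrM exprMn.
by field; rewrite mn0 expf_neq0.
Qed.

End unit_sphere.

Lemma hausdorff_sphere_finite (R : realType) (s : nat) :
  (hausdorff_outer s (@sphere R s.+1) < +oo)%E.
Proof.
set C : R := s%:R * Num.sqrt s.+1%:R + s%:R.
pose M : R := (2 * s.+1)%:R * 2 ^+ s * (@unit_ball_volume R s / 2 ^+ s) * C ^+ s.
apply: (@le_lt_trans _ _ M%:E); last exact: ltry.
apply: ge_ereal_sup => _ [e /= e0 <-].
have C0 : 0 <= C / e by rewrite divr_ge0 ?(ltW e0) // /C addr_ge0 ?mulr_ge0 ?sqrtr_ge0.
have := archi_boundP C0; set m := Num.bound _ => bnd.
have m0 : (0 < m)%N by rewrite -(ltr_nat R); exact: le_lt_trans bnd.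
apply: (@cover_measure_sphere_le R s m m0 e).
by rewrite ler_pdivrMr ?ltr0n // [leRHS]mulrC -ler_pdivrMr //; exact: ltW bnd.
Qed.

(** * Plane waves *)

Section plane_waves.
Context {R : realType} (s : nat).
Local Notation E := 'rV[R]_s.+1.
Local Notation surf := (surface R s.+1).

Lemma measurable_sphere : measurable (sphere : set (caratheodory_type
  (hausdorff_outer s : set E -> \bar R))).
Proof.
have mE : measurable_fun
    [set: caratheodory_type (hausdorff_outer s : set E -> \bar R)] (enorm : E -> R).
  by apply: (@lipschitz_measurable R s.+1 s _ 1) => // x y;
    rewrite mul1r enorm_lipschitz.
have := mE measurableT [set 1] (measurable_set1 1); rewrite setTI.
by congr (measurable _); apply/seteqP; split.
Qed.

Lemma plane_wave_L2 (k : R) (z : E) : L2 surf sphere (plane_wave k z).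
Proof.
have mdot : measurable_fun
    [set: caratheodory_type (hausdorff_outer s : set E -> \bar R)]
      (fun y => - (k * dot z y)).
  apply: (@lipschitz_measurable R s.+1 s _ (`|k| * enorm z + 1)).
    by rewrite ltr_wpDl // mulr_ge0 // enorm_ge0.
  move=> x y; rewrite -opprD normrN -mulrBr normrM mulrDl mul1r.
  apply: le_trans (_ : `|k| * enorm z * enorm (x - y) <= _).
    by rewrite -mulrA ler_wpM2l // dot_lipschitz.
  by rewrite lerDl enorm_ge0.
split.
  split; apply: measurable_funTS.
    by apply: (measurableT_comp _ mdot); apply: continuous_measurable_fun;
      exact: continuous_cos.
  by apply: (measurableT_comp _ mdot); apply: continuous_measurable_fun;
    exact: continuous_sin.
rewrite (_ : (fun _ => _) = cst 1%E).
  rewrite integral_cst ?mul1e; last exact: measurable_sphere.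
  exact: hausdorff_sphere_finite.
apply/funext => y; rewrite /plane_wave /cis normc_sqr /= cos2Dsin2 //.
Qed.

Lemma plane_wave_norm (k : R) (z : E) :
  L2norm surf sphere (plane_wave k z) = Num.sqrt (fine (surf sphere)).
Proof.
congr Num.sqrt; rewrite /Rintegral; congr fine.
rewrite (_ : (fun _ => _) = cst 1%E).
  by rewrite integral_cst ?mul1e //; exact: measurable_sphere.
by apply/funext => y; rewrite /plane_wave /cis normc_sqr /= cos2Dsin2.
Qed.

End plane_waves.

(** * The noisy far-field operator *)

Theorem theorem4p2 (R : realType) (d : nat) (d23 : d = 2%N \/ d = 3%N)
  (k : R) (k_gt0 : 0 < k)
  (D : set 'rV[R]_d) (D_bounded : bounded_set D) (D_open : open D)
  (D_C2 : C2_boundary D)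
  (nu : 'rV[R]_d -> 'rV[R]_d) (nuP : outward_unit_normal D nu)
  (n eta : 'rV[R]_d -> R[i])
  (nP : refractive_index D n) (etaP : conductivity D eta)
  (k_not_te : ~ transmission_eigenvalue k D nu n eta)
  (F Fsharp : operator R 'rV[R]_d)
  (FP : far_field_operator k D n eta F)
  (FsharpP : is_sharp (surface R d) sphere F Fsharp)
  (lambda1 : R) (lambda1_gt0 : 0 < lambda1)
  (lambda1P : largest_eigenvalue (surface R d) sphere Fsharp lambda1)
  (r : nat) (beta : R) (beta_gt0 : 0 < beta) (beta_lt : beta < 1 / lambda1)
  (eps : R) (eps_gt0 : 0 < eps)
  (P : {poly R[i]}) (P0 : P.[0] = 0)
  (P_Gamma : (Linfty_dist lambda1 P (Gamma_filter beta r) < eps%:E)%E)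
  (Fdelta Fdelta_sharp : R -> operator R 'rV[R]_d)
  (FdeltaP : forall delta : R, 0 < delta < 1 ->
    bounded_operator (surface R d) sphere (Fdelta delta))
  (Fdelta_sharpP : forall delta : R, 0 < delta < 1 ->
    is_sharp (surface R d) sphere (Fdelta delta) (Fdelta_sharp delta))
  (Fdelta_near : \forall delta \near (0 : R)^'+,
    opnorm (surface R d) sphere (op_sub (Fdelta delta) F) < delta) :
  forall A : set 'rV[R]_d, compact A ->
  exists C delta0 : R, [/\ 0 < C, 0 < delta0 < 1 &
    forall z, A z -> forall delta : R, 0 < delta < delta0 ->
      `| L2norm (surface R d) sphere
           (op_poly P (Fdelta_sharp delta) (plane_wave k z)) ^+ 2
         - L2norm (surface R d) sphere
             (op_poly P Fsharp (plane_wave k z)) ^+ 2 |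
      <= C * (1 + `| ln delta |) * delta].
Proof.
move=> A _.
have [s ds] : exists s, d = s.+1 by case: d23 => ->; [exists 1%N | exists 2%N].
subst d; have mS := @measurable_sphere R s.
have bF : bounded_operator (surface R s.+1) sphere F by case: FP.
have [V [ip [cl clP]]] := L2_model_exists (surface R s.+1) mS.
have [C C0 HC] := sharp_poly_perturbation mS clP P
  (Num.sqrt (fine (surface R s.+1 sphere))) bF FsharpP.
have [e /= e0 He] := Fdelta_near.
exists C, (Num.min e 2^-1); split => //.
  by rewrite lt_min e0 invr_gt0 ltr0n /= gt_min invf_lt1 ?ltr1n ?orbT.
move=> z _ delta /andP[del0]; rewrite lt_min => /andP[dele del1].
have del01 : 0 < delta < 1.
  by rewrite del0 (lt_trans del1) // invf_lt1 // ltr1n.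
have near_delta : opnorm (surface R s.+1) sphere (op_sub (Fdelta delta) F) < delta.
  apply: He => //=; by rewrite sub0r normrN gtr0_norm.
have bsub := bounded_sub mS clP (FdeltaP _ del01) bF.
have delta_le : op_le (surface R s.+1) sphere (op_sub (Fdelta delta) F) delta.
  move=> f Lf; apply: le_trans (op_le_opnorm mS clP bsub Lf) _.
  by rewrite ler_wpM2r ?L2norm_ge0 // ltW.
have wave_le : L2norm (surface R s.+1) sphere (plane_wave k z) <=
    Num.sqrt (fine (surface R s.+1 sphere)) by rewrite plane_wave_norm.
exact: (HC delta _ _ _ del01 (FdeltaP _ del01) (Fdelta_sharpP _ del01) delta_le
  (plane_wave_L2 k z) wave_le).
Qed.
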